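(* Let $f$ be a probability density function on $\mathbb{R}^d$ and let $x\in\mathbb{R}^d$ be a Lebesgue point of $f$ such that $f(x)>0$. For each $n\ge 1$ let $A_n(x)$ be the Voronoi cell with nucleus $x$ in the Voronoi diagram generated by $\{x,X_1,\dots,X_n\}$, where $X_1,\dots,X_n$ are i.i.d. with density $f$, and let $P_n(x)$ be the Voronoi cell with nucleus $x$ in the Voronoi diagram generated by $\{x\}\cup P_{nf(x)}$, where $P_{nf(x)}$ is a homogeneous Poisson point process on $\mathbb{R}^d$ with parameter $nf(x)$. Let $$G:\{\text{convex polytopes in }\mathbb{R}^d\}\to\mathbb{R}$$ be any function such that for every $n\ge 1$, $G(A_n(x))$ is measurable with respect to $\sigma(X_1,\dots,X_n)$ and $G(P_n(x))$ is measurable with respect to $\sigma(P_{nf(x)})$. Then $$\lim_{n\to\infty}\ \sup_{z\in\mathbb{R}}\left|\mathbb{P}\big(G(A_n(x))\le z\big)-\mathbb{P}\big(G(P_n(x))\le z\big)\right|=0.$$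
   Context: $d\ge1$ is an integer, $\|\cdot\|$ is the Euclidean norm on $\mathbb{R}^d$, $\lambda$ is Lebesgue measure on $\mathbb{R}^d$, and $B_{z,r}$ is the open ball with center $z$ and radius $r$. All random variables and point processes are defined on a probability space $(\Omega,\mathcal F,\mathbb P)$. A point $x\in\mathbb{R}^d$ is a Lebesgue point of $f$ if $\lim_{r\to0}\frac{1}{\lambda(B_{x,r})}\int_{B_{x,r}}|f(u)-f(x)|\,du=0$. Given a set $S$ of points of $\mathbb{R}^d$ and $s\in S$, the Voronoi cell with nucleus $s$ in the Voronoi diagram generated by $S$ is $\{p\in\mathbb{R}^d:\ \|p-s\|\le\|p-s'\|\ \text{for all } s'\in S\setminus\{s\}\}$. The term ''convex polytope'' includes unbounded convex sets formed by an intersection of half-spaces. A homogeneous Poisson point process $P_\Lambda$ with parameter $\Lambda>0$ is a random countable collection of points of $\mathbb{R}^d$ such that, writing $N(B)$ for the number of its points in $B$, for any positive integer $k$, any bounded, pairwise disjoint (Borel) sets $B_1,\dots,B_k\subseteq\mathbb{R}^d$ and any non-negative integers $m_1,\dots,m_k$, $$\mathbb{P}\big(N(B_i)=m_i,\ i=1,\dots,k\big)=\prod_{i=1}^k\frac{(\Lambda\lambda(B_i))^{m_i}}{m_i!}e^{-\Lambda\lambda(B_i)}.$$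
   Formalization: Measurability of G(A_n(x)) and G(P_n(x)) is assumed for every realization of the sample and of the Poisson process on every probability space; for one fixed pathological space (sample in a Bernstein set, Poisson points in its complement) the claim fails. *)

(* Defs.v *)
From HB Require Import structures.
From mathcomp Require Import all_boot all_order all_algebra.
From mathcomp Require Import ring lra.
From mathcomp Require Import all_classical all_reals all_analysis.
From mathcomp Require Import measurable_realfun.

Set Implicit Arguments.
Unset Strict Implicit.
Unset Printing Implicit Defensive.

Import Order.TTheory GRing.Theory Num.Theory.
Import numFieldNormedType.Exports.

Local Open Scope classical_set_scope.
Local Open Scope ring_scope.

(* 'rV[R]_d carries the sigma-algebra generated by the coordinates, that is,
   its Borel sigma-algebra. *)
Definition measure_rV_display : measure_display.
Proof. exact default_measure_display. Qed.

Section measurable_rV.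
Context {R : realType} {d : nat}.

Definition rV_coord (i : 'I_d) (v : 'rV[R]_d) : R := v 0 i.

Let rV_set0 : g_sigma_preimage rV_coord set0.
Proof. exact: sigma_algebra0. Qed.

Let rV_setC A : g_sigma_preimage rV_coord A -> g_sigma_preimage rV_coord (~` A).
Proof. exact: sigma_algebraC. Qed.

Let rV_bigcup (F : (set 'rV[R]_d)^nat) :
  (forall i, g_sigma_preimage rV_coord (F i)) ->
  g_sigma_preimage rV_coord (\bigcup_i (F i)).
Proof. exact: sigma_algebra_bigcup. Qed.

HB.instance Definition _ := @isMeasurable.Build measure_rV_display
  'rV[R]_d (g_sigma_preimage rV_coord) rV_set0 rV_setC rV_bigcup.

Lemma measurable_rV_coord (i : 'I_d) : measurable_fun [set: 'rV[R]_d] (rV_coord i).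
Proof.
move=> _ Y mY; rewrite setTI; apply: sub_sigma_algebra => /=.
rewrite -bigcup_seq/=; exists i => /=; first by rewrite mem_index_enum.
by exists Y => //; rewrite setTI.
Qed.

Lemma measurable_fun_rVP d' (T : measurableType d') (g : T -> 'rV[R]_d) :
  (forall i, measurable_fun [set: T] (fun t => g t 0 i)) ->
  measurable_fun [set: T] g.
Proof.
move=> mg.
have prefS : g_sigma_preimage (fun i => rV_coord i \o g) `<=` measurable.
  apply: smallest_sub; first exact: sigma_algebra_measurable.
  rewrite -bigcup_seq; apply: bigcup_sub => i _ A [B mB <-].
  exact: mg.
move=> _ A mA; apply: prefS; rewrite g_sigma_preimage_comp; by exists A.
Qed.

End measurable_rV.

(* Lebesgue measure on R^n, by induction on n: the image of the product of
   the Lebesgue measures on R and on R^n by (a, v) |-> (a, v_1, ..., v_n). *)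
Section lebesgue_rV.
Context {R : realType}.

Definition rV_cons n (p : measurableTypeR R * 'rV[R]_n) : 'rV[R]_n.+1 :=
  \row_i oapp (fun j => p.2 0 j) p.1 (unlift ord0 i).

Definition rV_uncons n (v : 'rV[R]_n.+1) : measurableTypeR R * 'rV[R]_n :=
  (v 0 0, \row_i v 0 (lift ord0 i)).

Lemma rV_consE0 n p : @rV_cons n p 0 0 = p.1.
Proof. by rewrite mxE unlift_none. Qed.

Lemma rV_consES n p i : @rV_cons n p 0 (lift ord0 i) = p.2 0 i.
Proof. by rewrite mxE liftK. Qed.

Lemma rV_consK n : cancel (@rV_cons n) (@rV_uncons n).
Proof.
move=> [a v]; rewrite /rV_uncons rV_consE0/=; congr pair.
by apply/rowP => i; rewrite mxE rV_consES.
Qed.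

Lemma measurable_rV_cons n : measurable_fun setT (@rV_cons n).
Proof.
apply: measurable_fun_rVP => i; have [j ->|->] := unliftP ord0 i.
  under eq_fun do rewrite rV_consES.
  exact: (measurableT_comp (measurable_rV_coord j) measurable_snd).
by under eq_fun do rewrite rV_consE0; exact: measurable_fst.
Qed.

Lemma measurable_rV_uncons n : measurable_fun setT (@rV_uncons n).
Proof.
apply/measurable_fun_pair => /=; first exact: measurable_rV_coord.
apply: measurable_fun_rVP => i /=.
by under eq_fun do rewrite mxE; exact: measurable_rV_coord.
Qed.

Section step.
Variables (n : nat) (mu : {sigma_finite_measure set 'rV[R]_n -> \bar R}).
Local Notation lmu := (product_measure1 (@lebesgue_measure R) mu).

Definition lebesgue_rV_step : set 'rV[R]_n.+1 -> \bar R :=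
  pushforward lmu (@rV_cons n).

Let step0 : lebesgue_rV_step set0 = 0%E.
Proof. by rewrite /lebesgue_rV_step /pushforward preimage_set0 measure0. Qed.

Let step_ge0 A : (0 <= lebesgue_rV_step A)%E.
Proof. by rewrite /lebesgue_rV_step /pushforward. Qed.

Let step_sigma_additive : semi_sigma_additive lebesgue_rV_step.
Proof.
exact: (@measure_semi_sigma_additive _ _ _
  (measure_function_pushforward__canonical__measure_function_Measure
     lmu (@measurable_rV_cons n))).
Qed.

HB.instance Definition _ := isMeasure.Build _ _ _ lebesgue_rV_step
  step0 step_ge0 step_sigma_additive.

Let step_sigma_finite : sigma_finite setT lebesgue_rV_step.
Proof.
have /sigma_finiteP[F [FT ndF Ffin]] := sigma_finiteT (@lebesgue_measure R).
have /sigma_finiteP[G [GT ndG Gfin]] := sigma_finiteT mu.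
exists (fun k => @rV_uncons n @^-1` (F k `*` G k)).
  rewrite -preimage_bigcup -[LHS](preimage_setT (@rV_uncons n)); congr (_ @^-1` _).
  rewrite -setXTT FT GT predeqE => -[a v]; split; last first.
    by move=> [k _ []/= ? ?]; split; exists k.
  move=> [/= [k _ Fka] [l _ Glv]]; exists (maxn k l) => //; split.
  - by move: a Fka; exact/subsetPset/ndF/leq_maxl.
  - by move: v Glv; exact/subsetPset/ndG/leq_maxr.
move=> k; have [mF Fk] := Ffin k; have [mG Gk] := Gfin k; split.
  rewrite -[X in measurable X]setTI.
  by apply: measurable_rV_uncons => //; exact: measurableX.
rewrite /lebesgue_rV_step /pushforward -comp_preimage.
rewrite (_ : _ \o _ = id) ?preimage_id; last exact/funext/rV_consK.
by rewrite product_measure1E// lte_mul_pinfty// ge0_fin_numE.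
Qed.

HB.instance Definition _ := Measure_isSigmaFinite.Build _ _ _ lebesgue_rV_step
  step_sigma_finite.

End step.

Fixpoint lebesgue_rV n : {sigma_finite_measure set 'rV[R]_n -> \bar R} :=
  if n is m.+1 then lebesgue_rV_step (lebesgue_rV m)
  else @dirac _ 'rV[R]_0 0 R.

End lebesgue_rV.
Arguments lebesgue_rV {R} n.

Lemma lebesgue_rV_box (R : realType) n (B : 'I_n -> set R) :
  (forall i, measurable (B i)) ->
  lebesgue_rV n [set v : 'rV[R]_n | forall i, B i (v 0 i)] =
  (\prod_(i < n) lebesgue_measure (B i))%E.
Proof.
elim: n B => [|n IHn] B mB.
  by rewrite big_ord0 /= diracE mem_set//= => -[].
rewrite big_ord_recl -(IHn (fun i => B (lift ord0 i)))//.
rewrite /= /lebesgue_rV_step /pushforward -product_measure1E; first last.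
  rewrite (_ : [set _ | _] = \bigcap_(i in [set: 'I_n])
     (rV_coord i @^-1` B (lift ord0 i))); last first.
    by apply/seteqP; split => [v Bv i _|v Bv i]; exact: Bv.
  apply: fin_bigcap_measurable => // i _.
  by rewrite -[X in measurable X]setTI; exact: measurable_rV_coord.
  exact: mB.
congr (product_measure1 _ _ _); apply/seteqP; split => [[a v] /= Bav|[a v] [/= Ba Bv] i].
  split; first by have := Bav ord0; rewrite rV_consE0.
  by move=> i; have := Bav (lift ord0 i); rewrite rV_consES.
by have [j ->|->] := unliftP ord0 i; rewrite ?rV_consES// rV_consE0.
Qed.

Section euclidean.
Context {R : realType} {d : nat}.
Implicit Types (u v p s : 'rV[R]_d) (S C : set 'rV[R]_d).

Definition dotrV u v : R := \sum_i u 0 i * v 0 i.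

(* The library norm `|v| on 'rV[R]_d is the sup norm, hence enorm. *)
Definition enorm v : R := Num.sqrt (dotrV v v).

Definition eball (z : 'rV[R]_d) (r : R) : set 'rV[R]_d :=
  [set y | enorm (y - z) < r].

Definition half_space C : Prop :=
  exists (a : 'rV[R]_d) (b : R), a != 0 /\ C = [set p | dotrV a p <= b].

(* Possibly unbounded, and the family of half-spaces may be infinite. *)
Definition convex_polytope C : Prop :=
  exists2 H : set (set 'rV[R]_d), H `<=` half_space & C = \bigcap_(h in H) h.

Definition polytope := {C : set 'rV[R]_d | convex_polytope C}.

Definition voronoi_set S s : set 'rV[R]_d :=
  [set p | forall s', (S `\ s) s' -> enorm (p - s) <= enorm (p - s')].

Lemma dotrVB u v : dotrV (u - v) (u - v) = dotrV u u - dotrV v u *+ 2 + dotrV v v.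
Proof.
rewrite /dotrV -sumrMnl -sumrB -big_split; apply: eq_bigr => i _ /=.
by rewrite !mxE; ring.
Qed.

Lemma enorm_le_half_space p s s' : (enorm (p - s) <= enorm (p - s')) =
  (dotrV (s' - s) p <= (dotrV s' s' - dotrV s s) / 2).
Proof.
rewrite /enorm ler_sqrt; last by apply: sumr_ge0 => i _; rewrite -expr2 sqr_ge0.
have -> : dotrV (s' - s) p = dotrV s' p - dotrV s p.
  by rewrite /dotrV -sumrB; apply: eq_bigr => i _; rewrite !mxE mulrBl.
by rewrite !dotrVB; apply/idP/idP; lra.
Qed.

Lemma voronoi_set_polytope S s : convex_polytope (voronoi_set S s).
Proof.
exists [set [set p | enorm (p - s) <= enorm (p - s')] | s' in S `\ s].
  move=> _ [s' [_ s's] <-]; exists (s' - s), ((dotrV s' s' - dotrV s s) / 2).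
  split; first by rewrite subr_eq0; exact/eqP.
  by apply/seteqP; split => p /=; rewrite enorm_le_half_space.
apply/seteqP; split => [p pS _ [s' Ss' <-]|p pS s' Ss']; first exact: pS.
by apply: (pS [set p | enorm (p - s) <= enorm (p - s')]); exists s'.
Qed.

Definition voronoi_cell S s : polytope :=
  exist convex_polytope _ (voronoi_set_polytope S s).

Definition probability_density (f : 'rV[R]_d -> R) : Prop :=
  [/\ measurable_fun setT f, forall y, 0 <= f y
    & (\int[lebesgue_rV d]_y (f y)%:E = 1)%E].

Definition lebesgue_point (f : 'rV[R]_d -> R) (x : 'rV[R]_d) : Prop :=
  ((lebesgue_rV d (eball x r))^-1 *
     \int[lebesgue_rV d]_(u in eball x r) `|f u - f x|%:E)%E
  @[r --> (0 : R)^'+] --> 0%E.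

End euclidean.
Arguments polytope : clear implicits.

Section random_points.
Context {R : realType} {d : nat} dO {O : measurableType dO}.

Definition mutually_independent (P : probability O R) n
    (X : 'I_n -> {RV P >-> 'rV[R]_d}) : Prop :=
  forall (J : {set 'I_n}) (B : 'I_n -> set 'rV[R]_d),
    (forall i, measurable (B i)) ->
    P (\bigcap_(i in [set` J]) X i @^-1` B i) =
    (\prod_(i in J) P (X i @^-1` B i))%E.

Definition iid_density (P : probability O R) n
    (X : 'I_n -> {RV P >-> 'rV[R]_d}) (f : 'rV[R]_d -> R) : Prop :=
  mutually_independent X /\
  forall i B, measurable B ->
    P (X i @^-1` B) = (\int[lebesgue_rV d]_(y in B) (f y)%:E)%E.

Definition num_points (Phi : O -> set 'rV[R]_d) (B : set 'rV[R]_d) (w : O)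
  : \bar R := counting (Phi w `&` B).

(* `poisson_pmf` is not used because it is constantly 1 at rate 0, whereas
   B i may be Lebesgue-null. *)
Definition poisson_process (P : probability O R) (L : R)
    (Phi : O -> set 'rV[R]_d) : Prop :=
  [/\ forall w, countable (Phi w),
      forall B, measurable B -> measurable_fun setT (num_points Phi B)
    & forall k (B : 'I_k -> set 'rV[R]_d) (m : 'I_k -> nat), (0 < k)%N ->
        (forall i, measurable (B i)) -> (forall i, bounded_set (B i)) ->
        trivIset setT B ->
        P [set w | forall i, num_points Phi (B i) w = (m i)%:R%:E] =
        (\prod_(i < k) (let t := L * fine (lebesgue_rV d (B i)) in
                        t ^+ m i / (m i)`!%:R * expR (- t)))%:E].

Definition sigma_process (Phi : O -> set 'rV[R]_d) : set_system O :=
  <<s \bigcup_(B in @measurable _ 'rV[R]_d)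
        preimage_set_system setT (num_points Phi B) measurable >>.

Definition measurable_wrt (S : set_system O) (g : O -> R) : Prop :=
  preimage_set_system setT g measurable `<=` S.

Definition sample_cell (x : 'rV[R]_d) n (X : 'I_n -> O -> 'rV[R]_d) (w : O)
  : polytope R d := voronoi_cell (x |` range (fun i => X i w)) x.

Definition process_cell (x : 'rV[R]_d) (Phi : O -> set 'rV[R]_d) (w : O)
  : polytope R d := voronoi_cell (x |` Phi w) x.

End random_points.

(* Measurability of G(A_n(x)) with respect to sigma(X_1, ..., X_n) is a
   condition on G as a functional of the sample, not on one particular
   realization of it: it is required of every sample with the given law, on
   every probability space; likewise for the Poisson process.  On a single
   space with a non-standard sigma-algebra, the sample and the process could
   take their values in disjoint sets, between which measurability with
   respect to the two sigma-algebras imposes no relation. *)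
Definition sample_measurable (R : realType) (d n : nat) (f : 'rV[R]_d -> R)
    (x : 'rV[R]_d) (G : polytope R d -> R) : Prop :=
  forall (dO : measure_display) (O : measurableType dO) (P : probability O R)
    (X : 'I_n -> {RV P >-> 'rV[R]_d}), iid_density X f ->
    measurable_wrt (g_sigma_preimage X) (fun w => G (sample_cell x X w)).

Definition process_measurable (R : realType) (d : nat) (L : R)
    (x : 'rV[R]_d) (G : polytope R d -> R) : Prop :=
  forall (dO : measure_display) (O : measurableType dO) (P : probability O R)
    (Phi : O -> set 'rV[R]_d), poisson_process P L Phi ->
    measurable_wrt (sigma_process Phi) (fun w => G (process_cell x Phi w)).

(* Main.v *)
(* Only the points in a cube of volume of order 1/n around x matter: if the
   2^d corner boxes of side t next to x (t^d = c/n) all contain a point, then the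
   cell of x depends only on the points within sup-distance 4dt of x, and for the
   Poisson process this fails with probability at most 2^d exp(-c f(x)).
   Inside the cube the two processes are compared in total variation as in Le
   Cam's theorem.  The sample is the superposition of n independent one-point
   processes, and the Poisson process of intensity n f(x) is, in law, the
   superposition of n independent Poisson processes of intensity f(x), because
   its law is determined by the counts.  Total variation is subadditive under
   independent superposition, and for one of the n factors the distance is at
   most 2 int_cube |f - f(x)| + (f(x) vol(cube))^2, which is o(1/n) at a
   Lebesgue point. *)
Require Import Defs.
From HB Require Import structures.
From mathcomp Require Import all_boot all_order all_algebra.
From mathcomp Require Import ring lra.
From mathcomp Require Import all_classical all_reals all_analysis.
From mathcomp Require Import measurable_realfun.
Import Order.TTheory GRing.Theory Num.Theory.
Import numFieldNormedType.Exports.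
Local Open Scope classical_set_scope.
Local Open Scope ring_scope.

Set Implicit Arguments.
Unset Strict Implicit.
Unset Printing Implicit Defensive.

(** [G] is arbitrary, so there is no continuity to exploit, and a coupling in which the two point
    sets are merely close would say nothing. The laws must be compared in total variation on one
    space, [config], and a single measurable set of configurations must describe the event [G <= z]
    for both processes. [process_event] extracts that set from the measurability assumed for the
    Poisson process. It describes the event only on configurations without repetitions, which is why
    ties in the sample have to be shown null. The cell sees infinitely many Poisson points; only the
    restriction to a bounded cube, almost surely finite, enters the comparison.

    The constant c is fixed before n, in terms of the tolerance, so that empty corners are unlikely;
    with c constant, the n errors of size o(1/n) still add up to o(1). *)

(** The fibres are countably many, so their masses determine everything. [C] carries no
    sigma-algebra: every [Q] is allowed. *)
Lemma measure_countable_eq (R : realType) (C : countType)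
    d1 (T1 : measurableType d1) d2 (T2 : measurableType d2)
    (m1 : {measure set T1 -> \bar R}) (m2 : {measure set T2 -> \bar R})
    (v1 : T1 -> C) (v2 : T2 -> C) :
  (forall c, measurable (v1 @^-1` [set c])) ->
  (forall c, measurable (v2 @^-1` [set c])) ->
  (forall c, m1 (v1 @^-1` [set c]) = m2 (v2 @^-1` [set c])) ->
  forall Q : set C, m1 (v1 @^-1` Q) = m2 (v2 @^-1` Q).
Proof.
move=> mv1 mv2 m12 Q.
(* Numbering the values by [pickle] gives a disjoint sequence whose terms are single fibres or
   empty. *)
pose F T (v : T -> C) n := [set t : T | choice.pickle (v t) = n /\ Q (v t)].
have FE T (v : T -> C) : v @^-1` Q = \bigcup_n F T v n.
  by apply/seteqP; split => [t Qt|t [n _ [_]]//]; exists (choice.pickle (v t)).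
have tF T (v : T -> C) : trivIset setT (F T v).
  by move=> i j _ _ [t [[<- _] [<- _]]].
have F1 T (v : T -> C) n :
    F T v n = if choice.unpickle n is Some c then
                if (choice.pickle c == n) && `[< Q c >] then v @^-1` [set c] else set0
              else set0.
  case E : (choice.unpickle n) => [c|]; last first.
    by rewrite -subset0 => t [tn _]; move: E; rewrite -tn choice.pickleK.
  case: ifPn => [/andP[/eqP cn /asboolP Qc]|nQ].
    apply/seteqP; split => t /= => [[]|vtc].
      by rewrite -cn => /(pcan_inj choice.pickleK).
    by split; rewrite vtc.
  rewrite -subset0 => t [tn Qt]; move: E; rewrite -tn choice.pickleK => -[tc].
  by move/negP: nQ; apply; rewrite -tn -tc eqxx; apply/asboolP.
have mF d (T : measurableType d) (v : T -> C) n :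
    (forall c, measurable (v @^-1` [set c])) -> measurable (F T v n).
  by move=> mv; rewrite F1; case: choice.unpickle => // c; case: ifP.
rewrite !FE !measure_semi_bigcup//.
- by apply: eq_eseriesr => n _; rewrite !F1; case: choice.unpickle => [c|];
    rewrite ?measure0//; case: ifP => _; rewrite ?m12// !measure0.
- by move=> i; exact: mF.
- by apply: bigcup_measurable => i _; exact: mF.
- by move=> i; exact: mF.
- by apply: bigcup_measurable => i _; exact: mF.
Qed.

Lemma measurable_fun_nat d (T : measurableType d) (g : T -> nat) :
  (forall m, measurable (g @^-1` [set m])) -> measurable_fun setT g.
Proof.
move=> mg _ Y _; rewrite setTI.
have -> : g @^-1` Y = \bigcup_(m in Y) (g @^-1` [set m]).
  apply/seteqP; split => [t Yt|t [m Ym /= gt]]; first by exists (g t).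
  by rewrite /preimage/= gt.
by apply: bigcup_measurable => m _.
Qed.

(** * Configurations *)

(* Finite multisets of points: the order of the points in the sequence is
   invisible to the sigma-algebra, which is generated by the counts. *)
Definition config (R : realType) (d : nat) := seq 'rV[R]_d.

Definition count_in (R : realType) d (B : set 'rV[R]_d) (s : config R d) : nat :=
  count (fun y => `[< B y >]) s.

(** Finite families of counts, rather than single counts, make these sets stable under intersection,
    as uniqueness of measures requires. *)
Definition count_cylinder (R : realType) d : set (set (config R d)) :=
  [set E | exists (I : finType) (B : I -> set 'rV[R]_d) (m : I -> nat),
     (forall i, measurable (B i)) /\
     E = [set s | forall i, count_in (B i) s = m i]].

Arguments count_cylinder : clear implicits.

HB.instance Definition _ (R : realType) d := Choice.on (config R d).
HB.instance Definition _ (R : realType) d := isPointed.Build (config R d) [::].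
HB.instance Definition _ (R : realType) d :=
  @isMeasurable.Build (sigma_display (count_cylinder R d)) (config R d)
  <<s count_cylinder R d >>
  (@sigma_algebra0 _ setT (count_cylinder R d))
  (@sigma_algebraC _ (count_cylinder R d))
  (@sigma_algebra_bigcup _ setT (count_cylinder R d)).

Section config_theory.
Context {R : realType} {d : nat}.
Local Notation V := 'rV[R]_d.
Local Notation config := (config R d).
Implicit Types (B : set V) (s : config).

Lemma measurable_count_vec (I : finType) (B : I -> set V) (m : I -> nat) :
  (forall i, measurable (B i)) ->
  measurable [set s : config | forall i, count_in (B i) s = m i].
Proof. by move=> mB; apply: sub_sigma_algebra; exists I, B, m. Qed.

Lemma measurable_count_eq B m :
  measurable B -> measurable [set s : config | count_in B s = m].
Proof.
move=> mB; have := @measurable_count_vec unit (fun=> B) (fun=> m) (fun=> mB).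
by congr (measurable _); apply/seteqP; split => s /= => [/(_ tt)|].
Qed.

Lemma measurable_count B : measurable B -> measurable_fun setT (@count_in R d B).
Proof. by move=> mB; apply: measurable_fun_nat => m; exact: measurable_count_eq. Qed.

Lemma measurable_fun_config d' (T : measurableType d') (g : T -> config) :
  (forall B, measurable B -> measurable_fun setT (fun t => count_in B (g t))) ->
  measurable_fun setT g.
Proof.
move=> mg; apply: (@measurability _ _ _ _ _ _ (count_cylinder R d)) => //.
move=> _ [_ [I [B [m [mB ->]]]] <-]; rewrite setTI.
have -> : g @^-1` [set s | forall i, count_in (B i) s = m i] =
    \bigcap_(i in [set: I]) ((fun t => count_in (B i) (g t)) @^-1` [set m i]).
  by apply/seteqP; split => [t gt i _|t gt i]; [exact: gt|exact: gt].
apply: fin_bigcap_measurable => // i _.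
by rewrite -[X in measurable X]setTI; apply: mg.
Qed.

Lemma count_in_cat B s s' : count_in B (s ++ s') = (count_in B s + count_in B s')%N.
Proof. exact: count_cat. Qed.

Section atoms.
Variables (I : finType) (B : I -> set V).

(** An atom of the Boolean algebra generated by the [B i]; atoms turn an overlapping family into a
    disjoint one. *)
Definition atom (b : {set I}) : set V := [set y | forall i, B i y <-> i \in b].

Lemma measurable_atom b : (forall i, measurable (B i)) -> measurable (atom b).
Proof.
move=> mB.
have -> : atom b = \bigcap_(i in [set: I]) (if i \in b then B i else ~` B i).
  apply/seteqP; split => [y yb i _|y yb i].
    by case: ifPn => [/yb//|ib]; apply: contra_not (negP ib) => /yb.
  by have := yb i Logic.I; case: ifPn => [//|/negP ib nBiy]; split.
apply: fin_bigcap_measurable => // i _; case: ifP => // _; exact: measurableC.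
Qed.

Lemma atomE b y : atom b y <-> b = [set i | `[< B i y >]]%SET.
Proof.
split => [yb|-> i]; last by rewrite inE; split => [|/asboolP//] /asboolP.
apply/setP => i; rewrite inE; apply/idP/asboolP => /yb//.
Qed.

Lemma trivIset_atom : trivIset setT atom.
Proof. by move=> b b' _ _ [y [/atomE -> /atomE ->]]. Qed.

(** Each point lies in exactly one atom, indexed by [b0] in the proof, and that atom enters the sum
    iff [i] belongs to [b0]. *)
Lemma count_atom i s :
  count_in (B i) s = (\sum_(b : {set I} | i \in b) count_in (atom b) s)%N.
Proof.
elim: s => [|y s IH] /=; first by rewrite big1.
rewrite /count_in /= -/(count_in _ _) IH big_split/=; congr addn.
pose b0 := [set i | `[< B i y >]]%SET.
have E b : `[< atom b y >] = (b == b0) by apply/asboolP/eqP => /atomE.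
have -> : `[< B i y >] = (i \in b0) by rewrite inE.
rewrite big_mkcond (bigD1 b0)//= E eqxx big1 ?addn0; first by case: (i \in b0).
by move=> b /negbTE bb0; rewrite E bb0; case: ifP.
Qed.

End atoms.

(** Poisson laws prescribe counts only in disjoint sets, while the generating cylinders involve
    overlapping ones. Overlapping counts are functions of the counts in the atoms, and that vector
    takes countably many values. *)
Lemma config_law_unique (m1 m2 : probability config R) :
  (forall (I : finType) (B : I -> set V) (c : I -> nat),
    (forall i, measurable (B i)) -> trivIset setT B ->
    m1 [set s | forall i, count_in (B i) s = c i] =
    m2 [set s | forall i, count_in (B i) s = c i]) ->
  forall A, measurable A -> m1 A = m2 A.
Proof.
move=> m12.
apply: (measure_unique (count_cylinder R d) (fun=> setT)) => //.
- move=> _ _ [I [B [m [mB ->]]]] [J [C [n [mC ->]]]].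
  exists (I + J)%type, (fun x => match x with inl i => B i | inr j => C j end),
    (fun x => match x with inl i => m i | inr j => n j end); split.
    by case.
  apply/seteqP; split => [s [sI sJ] []//|s h].
  by split => [i|j]; [exact: (h (inl i))|exact: (h (inr j))].
- move=> _; exists void, (fun=> setT), (fun=> 0%N); split => //.
  by apply/seteqP; split => // s _ [].
- by apply/seteqP; split => // s _; exists 0%N.
- move=> _ [I [B [m [mB ->]]]].
  pose v s := [ffun b => count_in (atom B b) s] : {ffun {set I} -> nat}.
  pose Q := [set c : {ffun {set I} -> nat} |
    forall i, (\sum_(b : {set I} | i \in b) c b)%N = m i].
  have vE c : v @^-1` [set c] = [set s | forall b, count_in (atom B b) s = c b].
    apply/seteqP; split => [s <- b|s sc]; first by rewrite /v ffunE.
    by apply/ffunP => b; rewrite /v ffunE.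
  have -> : [set s | forall i, count_in (B i) s = m i] = v @^-1` Q.
    by apply/seteqP; split => s h i; rewrite -h count_atom/=;
      apply: eq_bigr => b _; rewrite ffunE.
  have mA b : measurable (atom B b) by exact: measurable_atom.
  apply: measure_countable_eq => c; rewrite vE; [exact: measurable_count_vec..|].
  by apply: m12 => //; exact: trivIset_atom.
- by move=> _; rewrite [X in (X < _)%E]probability_setT ltry.
Qed.

End config_theory.

(** * Finite unions, image laws and Poisson weights *)

Lemma measure_bigcup_fintype (R : realType) d (T : measurableType d)
    (m : {measure set T -> \bar R}) (I : finType) (F : I -> set T) :
  (forall i, measurable (F i)) -> trivIset setT F ->
  m (\bigcup_i F i) = (\sum_i m (F i))%E.
Proof.
move=> mF tF; rewrite measure_fin_bigcup//; last exact: finite_finset.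
rewrite [RHS]fsbig_seq ?index_enum_uniq//; congr (\big[_/_]_(_ \in _) _).
by apply/seteqP; split => // i _ /=; rewrite mem_index_enum.
Qed.

Lemma measure_bigcup_fintype_le (R : realType) d (T : measurableType d)
    (m : {measure set T -> \bar R}) (I : finType) (F : I -> set T) :
  (forall i, measurable (F i)) -> (m (\bigcup_i F i) <= \sum_i m (F i))%E.
Proof.
move=> mF; rewrite [leRHS]fsbig_seq ?index_enum_uniq//.
apply: content_sub_fsum => //.
  by apply: fin_bigcup_measurable => //; exact: finite_finset.
by move=> t [i _ Fit]; exists i => //=; rewrite mem_index_enum.
Qed.

Definition law (R : realType) d d' (T : measurableType d) (T' : measurableType d')
    (P : probability T R) (f : T -> T') (mf : measurable_fun setT f) :
  probability T' R := distribution P (mfun_Sub (mem_set mf)).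

Lemma lawE (R : realType) d d' (T : measurableType d) (T' : measurableType d')
    (P : probability T R) (f : T -> T') (mf : measurable_fun setT f) A :
  law P mf A = P (f @^-1` A).
Proof. by []. Qed.

(** At rate 0 this is the point mass at 0, as counts in null sets require. *)
Definition pois (R : realType) (t : R) (k : nat) : R :=
  t ^+ k / k`!%:R * expR (- t).

(** The binomial theorem, with ['C(c, j)] over [c!] written as the inverse of [j! (c - j)!]. *)
Lemma pois_conv (R : realType) (s t : R) c :
  \sum_(j < c.+1) pois s j * pois t (c - j) = pois (s + t) c.
Proof.
rewrite /pois opprD expRD [s + t]addrC exprDn mulr_suml mulr_suml.
apply: eq_bigr => j _; have jc : (j <= c)%N by rewrite -ltnS.
rewrite -mulr_natr.
have <- : ('C(c, j) * (j`! * (c - j)`!))%N = c`! by exact: bin_fact.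
have := fact_gt0 j; have := fact_gt0 (c - j).
have : (0 < 'C(c, j))%N by rewrite bin_gt0.
rewrite !natrM -!(ltr_nat R) => /lt0r_neq0 ? /lt0r_neq0 ? /lt0r_neq0 ?.
by field; apply/and3P.
Qed.

(** * Superposition *)

Section conv.
Context {R : realType} {d : nat}.
Local Notation V := 'rV[R]_d.
Local Notation config := (config R d).
Implicit Types m : probability config R.

Definition config_cat (p : config * config) : config := p.1 ++ p.2.

Lemma measurable_config_cat : measurable_fun setT config_cat.
Proof.
apply: measurable_fun_config => B mB.
under eq_fun do rewrite /config_cat count_in_cat.
apply: measurable_fun_addn.
  exact: (measurableT_comp (measurable_count mB) measurable_fst).
exact: (measurableT_comp (measurable_count mB) measurable_snd).
Qed.

(** The law of the superposition of two independent configurations. *)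
Definition conv m1 m2 : probability config R :=
  law ((m1 \x m2)%E : probability _ R) measurable_config_cat.

Fixpoint conv_pow m n : probability config R :=
  if n is k.+1 then conv m (conv_pow m k) else dirac ([::] : config).

(** Total variation distance at most [e]. The one-sided inequality is enough, since complements
    exchange the two laws. *)
Definition tv_le m1 m2 (e : R) :=
  forall A, measurable A -> (m1 A <= m2 A + e%:E)%E.

(** The two factors are replaced one at a time, through the mixed product of [m1] and [m2']; each
    replacement is made section by section under the integral. *)
Lemma tv_le_conv m1 m1' m2 m2' e e' : 0 <= e -> 0 <= e' ->
  tv_le m1 m1' e -> tv_le m2 m2' e' -> tv_le (conv m1 m2) (conv m1' m2') (e + e').
Proof.
move=> e0 e'0 h h' A mA; rewrite /conv !lawE.
have mC : measurable (config_cat @^-1` A).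
  by rewrite -[X in measurable X]setTI; exact: measurable_config_cat.
set C := config_cat @^-1` A in mC *.
have int1 (m : probability config R) : (\int[m]_x (e'%:E) = e'%:E)%E.
  by rewrite integral_cst// [X in (_ * X)%E]probability_setT mule1.
have int1' (m : probability config R) : (\int[m]_x (e%:E) = e%:E)%E.
  by rewrite integral_cst// [X in (_ * X)%E]probability_setT mule1.
have step1 : ((m1 \x m2) C <= (m1 \x m2') C + e'%:E)%E.
  rewrite /product_measure1 -[in leRHS](int1 m1) -ge0_integralD//=.
  - apply: ge0_le_integral => //=.
    + exact: measurable_fun_xsection.
    + by apply: emeasurable_funD => //; exact: measurable_fun_xsection.
    + by move=> x _; apply: h'; exact: measurable_xsection.
  - exact: measurable_fun_xsection.
(* Replacing the first factor needs sections in the other direction, hence the other iterated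
   integral. *)
have swap (m m' : probability config R) : (m \x m')%E C = (m \x^ m')%E C.
  by apply: product_measure_unique => // X Y mX mY; exact: product_measure2E.
have step2 : ((m1 \x m2') C <= (m1' \x m2') C + e%:E)%E.
  rewrite !swap /product_measure2 -[in leRHS](int1' m2') -ge0_integralD//=.
  - apply: ge0_le_integral => //=.
    + exact: measurable_fun_ysection.
    + by apply: emeasurable_funD => //; exact: measurable_fun_ysection.
    + by move=> x _; apply: h; exact: measurable_ysection.
  - exact: measurable_fun_ysection.
apply: (le_trans step1); rewrite EFinD addeA; exact: leeD2r.
Qed.

Lemma tv_le_conv_pow m m' e n : 0 <= e -> tv_le m m' e ->
  tv_le (conv_pow m n) (conv_pow m' n) (n%:R * e).
Proof.
move=> e0 h; elim: n => [|n IH] /=; first by move=> A mA; rewrite mul0r adde0.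
rewrite -natr1 mulrDl mul1r addrC; apply: tv_le_conv => //.
by rewrite mulr_ge0.
Qed.

(** The finite-dimensional laws of a Poisson process. [rate] is an arbitrary set function, so that
    superposition merely adds rates. *)
Definition poisson_counts m (rate : set V -> R) :=
  forall (I : finType) (B : I -> set V) (c : I -> nat),
    (forall i, measurable (B i)) -> trivIset setT B ->
    m [set s | forall i, count_in (B i) s = c i] =
    (\prod_i pois (rate (B i)) (c i))%:E.

Lemma poisson_counts_unique m m' rate :
  poisson_counts m rate -> poisson_counts m' rate ->
  forall A, measurable A -> m A = m' A.
Proof.
move=> h h'; apply: config_law_unique => I B c mB tB.
by rewrite h// h'.
Qed.

Lemma poisson_counts_dirac :
  poisson_counts (dirac ([::] : config)) (fun=> 0).
Proof.
move=> I B c mB tB; rewrite /= diracE; congr _%:E.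
have [/forallP c0|/forallPn[i ci]] := boolP [forall i, c i == 0%N].
  rewrite mem_set/=; last by move=> i; rewrite (eqP (c0 i)).
  rewrite big1// => i _; rewrite /pois (eqP (c0 i)) oppr0 expR0 fact0 expr0.
  by rewrite invr1 !mulr1.
rewrite memNset/=; last by move/(_ i)/esym/eqP; exact/negP.
by rewrite (bigD1 i)//= /pois expr0n (negbTE ci) !mul0r.
Qed.

(** Splitting along the counts [a] of the first configuration gives disjoint rectangles. The sum
    over [a] of products over [I] is a product of sums, each of them an instance of [pois_conv]. *)
Lemma poisson_counts_conv m1 m2 r1 r2 :
  poisson_counts m1 r1 -> poisson_counts m2 r2 ->
  poisson_counts (conv m1 m2) (fun B => r1 B + r2 B).
Proof.
move=> h1 h2 I B c mB tB; rewrite /conv lawE.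
(* A common bound on all counts, so that the vectors [a] range over a finite type. *)
pose M := (\sum_i c i)%N.
have cM i : (c i <= M)%N by rewrite /M (bigD1 i)//= leq_addr.
pose S1 (a : {ffun I -> 'I_M.+1}) :=
  [set s : config | forall i, count_in (B i) s = a i].
(* The additive form makes this set empty when [a i] exceeds [c i], where truncated subtraction
   would not. *)
pose S2 (a : {ffun I -> 'I_M.+1}) :=
  [set s : config | forall i, (a i + count_in (B i) s)%N = c i].
have S2E a : S2 a = if [forall i, (a i <= c i)%N]
    then [set s | forall i, count_in (B i) s = (c i - a i)%N] else set0.
  case: ifPn => [/forallP ac|/forallPn[i aci]].
    apply/seteqP; split => s sa i; first by rewrite -(sa i) addKn.
    by rewrite sa subnKC.
  by rewrite -subset0 => s /(_ i) sa; move: aci; rewrite -sa leq_addr.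
have mS1 a : measurable (S1 a) by exact: measurable_count_vec.
have mS2 a : measurable (S2 a).
  by rewrite S2E; case: ifP => // _; exact: measurable_count_vec.
rewrite (_ : _ @^-1` _ = \bigcup_a (S1 a `*` S2 a)); last first.
  apply/seteqP; split => [[s s'] ss'|[s s'] [a _ [/= sa s'a]] i].
    have lec i : (count_in (B i) s < M.+1)%N.
      by rewrite ltnS (leq_trans _ (cM i))// -ss' count_in_cat leq_addr.
    exists [ffun i => Ordinal (lec i)] => //; split => i /=; rewrite ffunE//=.
    by rewrite -ss' /config_cat count_in_cat.
  by rewrite /config_cat count_in_cat/= sa s'a.
rewrite measure_bigcup_fintype; first last.
- move=> a b _ _ [[s s'] [[/= sa _] [/= sb _]]].
  by apply/ffunP => i; apply/val_inj; rewrite /= -sa -sb.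
- by move=> a; exact: measurableX.
pose g i (j : 'I_M.+1) := if (j <= c i)%N
  then pois (r1 (B i)) j * pois (r2 (B i)) (c i - j) else 0.
transitivity (\sum_(a : {ffun I -> 'I_M.+1}) (\prod_i g i (a i))%:E)%E.
  apply: eq_bigr => a _.
  rewrite [LHS](_ : _ = m1 (S1 a) * m2 (S2 a))%E; last exact: product_measure1E.
  rewrite (h1 I B (fun i => a i))// S2E; case: ifPn => [/forallP ac|/forallPn[i aci]].
    rewrite (h2 I B (fun i => c i - a i)%N)// -EFinM -big_split/=; congr _%:E.
    by apply: eq_bigr => i _; rewrite /g ac.
  by rewrite measure0 mule0 (bigD1 i)//= /g (negbTE aci) mul0r.
rewrite sumEFin; congr _%:E.
rewrite -(bigA_distr_bigA g); apply: eq_bigr => i _.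
rewrite /g -big_mkcond/= (big_ord_narrow_leq (cM i))/=.
exact: pois_conv.
Qed.

Lemma poisson_counts_conv_pow m r n :
  poisson_counts m r -> poisson_counts (conv_pow m n) (fun B => n%:R * r B).
Proof.
move=> h; elim: n => [|n IH].
  rewrite (_ : (fun _ => _) = fun=> 0); first exact: poisson_counts_dirac.
  by apply/funext => B; rewrite mul0r.
rewrite (_ : (fun _ => _) = fun B => r B + n%:R * r B).
  exact: poisson_counts_conv.
by apply/funext => B; rewrite -natr1 mulrDl mul1r addrC.
Qed.

End conv.

Lemma pois_sum (R : realType) (t : R) : 0 < t ->
  (\sum_(k <oo) (pois t k)%:E = 1)%E.
Proof.
move=> t0; have := probability_setT (poisson_prob t 0%N : probability nat R).
rewrite /= /poisson_prob t0 -nneseries_esumT; last first.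
  by move=> *; rewrite lee_fin poisson_pmf_ge0.
by under eq_eseriesr do rewrite /poisson_pmf t0.
Qed.

Lemma probabilityI_conull (R : realType) d (T : measurableType d)
    (P : probability T R) (F : set T) : measurable F -> P F = 1%E ->
  forall A, measurable A -> P (A `&` F) = P A.
Proof.
move=> mF PF A mA; rewrite [RHS](measureDI P mA mF)//.
rewrite [X in (X + _)%E](_ : _ = 0%E) ?add0e//.
apply/eqP; rewrite eq_le measure_ge0 andbT.
have <- : P (~` F) = 0%E by rewrite probability_setC// PF subee.
apply: le_measure; rewrite ?inE; [exact: measurableD|exact: measurableC|].
by move=> x [].
Qed.

(** * Poisson processes *)

Section points.
Context {R : realType} {d : nat}.
Local Notation V := 'rV[R]_d.
Implicit Types S B : set V.

(* The empty configuration when [S] is infinite. *)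
Definition points S : config R d := finmap.enum_fset (fset_set S).

Lemma mem_points S y : finite_set S -> (y \in points S) = (y \in S).
Proof. by move=> fS; rewrite -(in_fset_set fS). Qed.

Lemma points_uniq S : uniq (points S).
Proof. exact: finmap.fset_uniq. Qed.

Lemma points_infinite S : infinite_set S -> points S = [::].
Proof.
move=> iS; by rewrite /points /fset_set; case: pselect.
Qed.

Lemma set_points S : finite_set S -> [set` points S] = S.
Proof.
by move=> fS; apply/seteqP; split => y /=; rewrite mem_points// inE.
Qed.

(** [counting] ignores multiplicities and [count_in] does not; without repetitions they agree. *)
Lemma counting_seq B (s : config R d) : uniq s ->
  counting ([set` s] `&` B) = (count_in B s)%:R%:E :> \bar R.
Proof.
move=> us.
have -> : [set` s] `&` B = [set` [seq y <- s | `[< B y >]]].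
  apply/seteqP; split => y /=; first by case=> ys /asboolP By; rewrite mem_filter By.
  by rewrite mem_filter => /andP[/asboolP].
rewrite /counting asboolT; last exact: finite_seq.
rewrite /count_in -size_filter; congr (_%:R%:E).
set s' := [seq y <- s | _].
apply: perm_size; apply: uniq_perm; [exact: finmap.fset_uniq|exact: filter_uniq|].
move=> y; rewrite [LHS](in_fset_set (finite_seq s')).
by apply/idP/idP => [/set_mem|/mem_set].
Qed.

Lemma counting_points S B : finite_set S ->
  counting (S `&` B) = (count_in B (points S))%:R%:E :> \bar R.
Proof.
by move=> fS; rewrite -counting_seq ?points_uniq// set_points.
Qed.

End points.

Lemma bounded_setS (K : numFieldType) (V : pseudoMetricNormedZmodType K)
    (A B : set V) : A `<=` B -> bounded_set B -> bounded_set A.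
Proof.
by move=> AB [M [Mr BM]]; exists M; split=> // x xM y /AB; exact: BM.
Qed.

Section process.
Context {R : realType} {d : nat} dO {O : measurableType dO}.
Variables (P : probability O R) (L : R) (Phi : O -> set 'rV[R]_d).
Hypothesis Phi_poisson : poisson_process P L Phi.
Variable D : set 'rV[R]_d.
Hypotheses (mD : measurable D) (bD : bounded_set D).
Hypothesis tD : 0 < L * fine (lebesgue_rV d D).
Local Notation V := 'rV[R]_d.

Let fin_event := [set w | finite_set (Phi w `&` D)].

Let num_fin w B : finite_set (Phi w `&` D) ->
  num_points Phi (D `&` B) w = (count_in B (points (Phi w `&` D)))%:R%:E.
Proof. by move=> fw; rewrite /num_points setIA counting_points. Qed.

Let measurable_num B m : measurable B ->
  measurable [set w | num_points Phi B w = m%:R%:E].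
Proof.
move=> mB; have [_ mN _] := Phi_poisson.
by rewrite -[X in measurable X]setTI; exact: (mN _ mB measurableT [set m%:R%:E]).
Qed.

Let fin_eventE : fin_event = \bigcup_m [set w | num_points Phi D w = m%:R%:E].
Proof.
apply/seteqP; split => [w fw|w [m _]].
  exists (count_in setT (points (Phi w `&` D))) => //=.
  by rewrite -num_fin// setIT.
rewrite /= /num_points /counting; case: asboolP => //.
Qed.

Lemma measurable_finite_process : measurable fin_event.
Proof.
by rewrite fin_eventE; apply: bigcup_measurable => m _; exact: measurable_num.
Qed.

(** Each [Phi w] is only known to be countable. Finiteness in [D] holds almost surely because the
    Poisson weights of the finite counts already sum to 1. *)
Lemma finite_process : P fin_event = 1%E.
Proof.
have [_ _ fdd] := Phi_poisson.
rewrite fin_eventE measure_semi_bigcup; first last.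
- by rewrite -fin_eventE; exact: measurable_finite_process.
- move=> i j _ _ [w [/= -> [/eqP]]].
  by rewrite eqr_nat => /eqP.
- by move=> m; exact: measurable_num.
rewrite -[RHS](pois_sum tD); apply: eq_eseriesr => m _.
have := fdd 1%N (fun=> D) (fun=> m) isT (fun=> mD) (fun=> bD).
rewrite big_ord1 => <-; last by move=> i j; rewrite !ord1.
by congr (P _); apply/seteqP; split => w //= /(_ ord0).
Qed.

Lemma measurable_points : measurable_fun setT (fun w => points (Phi w `&` D)).
Proof.
apply: measurable_fun_config => B mB; apply: measurable_fun_nat => m.
(* Off [fin_event] the configuration is empty by convention, so every count there is 0. *)
rewrite (_ : _ @^-1` _ =
  (fin_event `&` [set w | num_points Phi (D `&` B) w = m%:R%:E]) `|`
  (~` fin_event `&` (if m == 0%N then setT else set0))).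
  have mF := measurable_finite_process.
  apply: measurableU; apply: measurableI => //.
  - by apply: measurable_num; exact: measurableI.
  - exact: measurableC.
  - by case: ifP.
apply/seteqP; split => [w /= wm|w [[fw /=]|[nfw]]].
- have [fw|nfw] := pselect (finite_set (Phi w `&` D)).
    by left; split => //=; rewrite num_fin// wm.
  by right; split => //; rewrite -wm points_infinite.
- by rewrite num_fin// => -[/eqP]; rewrite eqr_nat => /eqP.
- by case: eqP => // -> _ /=; rewrite points_infinite.
Qed.

Lemma process_poisson_counts : poisson_counts (law P measurable_points)
  (fun B => L * fine (lebesgue_rV d (D `&` B))).
Proof.
move=> I B c mB tB; rewrite lawE.
have mF := measurable_finite_process; have PF := finite_process.
have [_ _ fdd] := Phi_poisson.
set E := _ @^-1` _.
pose E' := [set w | forall i : 'I_#|I|,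
  num_points Phi (D `&` B (enum_val i)) w = (c (enum_val i))%:R%:E].
have mE : measurable E.
  rewrite -[X in measurable X]setTI; apply: measurable_points => //.
  exact: measurable_count_vec.
have mDB i : measurable (D `&` B i) by exact: measurableI.
have mE' : measurable E'.
  rewrite (_ : E' = \bigcap_(i in [set: 'I_#|I|]) [set w |
     num_points Phi (D `&` B (enum_val i)) w = (c (enum_val i))%:R%:E]).
    by apply: fin_bigcap_measurable => // i _; exact: measurable_num.
  by apply/seteqP; split => [w h i _|w h i]; exact: h.
rewrite -(probabilityI_conull mF PF mE).
have -> : E `&` fin_event = E' `&` fin_event.
  apply/seteqP; split => w [Ew fw]; split => // i.
    by rewrite num_fin// -(Ew (enum_val i)).
  have := Ew (enum_rank i); rewrite num_fin// enum_rankK => -[/eqP].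
  by rewrite eqr_nat => /eqP.
rewrite (probabilityI_conull mF PF mE').
(* The law of [Phi] is prescribed for at least one set; for an empty family both sides are 1. *)
have [I0|] := posnP #|I|.
  rewrite (_ : E' = setT); last first.
    apply/seteqP; split => // w _ i; have := ltn_ord i.
    by rewrite [in X in (_ < X)%N -> _]I0.
  rewrite probability_setT big1// => i _.
  by have := max_card (pred1 i); rewrite card1 I0.
move=> I0; rewrite /E' fdd//; last 2 first.
- by move=> i; apply: (bounded_setS _ bD) => y [].
- move=> i j _ _ [w [[_ Bi] [_ Bj]]]; apply: enum_val_inj.
  by apply: tB => //; exists w.
congr (_%:E).
by rewrite [RHS](reindex _ (onW_bij _ (enum_val_bij I))).
Qed.

End process.

(** Given [E], the pair has a law that agrees with the product on rectangles, hence everywhere.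
    Conditioning on [E] lets an induction carry the remaining coordinates along; a null [E] is
    treated apart since [P E] is divided out. *)
Lemma joint_law_prod (R : realType) d (T : measurableType d)
    d1 (T1 : measurableType d1) d2 (T2 : measurableType d2)
    (P : probability T R) (m1 : probability T1 R) (m2 : probability T2 R)
    (f1 : T -> T1) (f2 : T -> T2) (E : set T) :
  measurable_fun setT f1 -> measurable_fun setT f2 -> measurable E ->
  (forall A B, measurable A -> measurable B ->
    P ((f1 @^-1` A `&` f2 @^-1` B) `&` E) = (m1 A * m2 B * P E)%E) ->
  forall C, measurable C ->
    P ((fun t => (f1 t, f2 t)) @^-1` C `&` E) = ((m1 \x m2) C * P E)%E.
Proof.
move=> mf1 mf2 mE h C mC.
have mf : measurable_fun setT (fun t => (f1 t, f2 t)) by exact: measurable_fun_pair.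
have mfC : measurable ((fun t => (f1 t, f2 t)) @^-1` C).
  by rewrite -[X in measurable X]setTI; exact: mf.
have PEfin : P E \is a fin_num by exact: fin_num_measure.
have [PE0|PE0] := eqVneq (P E) 0%E.
  apply/eqP; rewrite PE0 mule0 eq_le measure_ge0 andbT -PE0.
  by apply: le_measure; rewrite ?inE//; exact: measurableI.
have e0 : 0 < fine (P E).
  by rewrite lt_neqAle eq_sym fine_eq0// PE0 fine_ge0.
have e1 : ((fine (P E))^-1%:E * P E = 1)%E.
  by rewrite -{2}(fineK PEfin) -EFinM mulVf// gt_eqF.
have ri : 0 <= (fine (P E))^-1 by rewrite invr_ge0 ltW.
pose r : {nonneg R} := NngNum ri.
pose mu := measure_function_pushforward__canonical__measure_function_Measure
  (mrestr P mE) mf.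
have -> : ((m1 \x m2) C = (fine (P E))^-1%:E *
    P ((fun t => (f1 t, f2 t)) @^-1` C `&` E))%E.
  apply: (@product_measure_unique _ _ _ _ _ m1 m2 (mscale r mu)) => // A B mA mB.
  rewrite [LHS](_ : _ = (fine (P E))^-1%:E *
    P ((f1 @^-1` A `&` f2 @^-1` B) `&` E))%E//.
  by rewrite h// muleCA e1 mule1.
by rewrite muleAC e1 mul1e.
Qed.

(** * Samples *)

Section sample.
Context {R : realType} {d : nat}.
Local Notation V := 'rV[R]_d.
Local Notation config := (config R d).

Definition restrict (D : set V) (s : config) : config :=
  [seq y <- s | `[< D y >]].

Lemma count_in_restrict (D B : set V) s :
  count_in B (restrict D s) = count_in (D `&` B) s.
Proof.
rewrite /count_in /restrict count_filter; apply: eq_count => y /=.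
by apply/andP/asboolP => [[/asboolP By /asboolP Dy]|[Dy By]];
  [split|split; exact/asboolP].
Qed.

Lemma measurable_singleton (D : set V) : measurable D ->
  measurable_fun setT (fun y => restrict D [:: y]).
Proof.
move=> mD; apply: measurable_fun_config => B mB; apply: measurable_fun_nat => m.
have E y : count_in B (restrict D [:: y]) = nat_of_bool `[< (D `&` B) y >].
  by rewrite count_in_restrict /count_in/= addn0.
have mDB : measurable (D `&` B) by exact: measurableI.
rewrite (_ : _ @^-1` _ = (if m == 1%N then D `&` B else
  if m == 0%N then ~` (D `&` B) else set0)).
  by case: ifP => // _; case: ifP => // _; exact: measurableC.
apply/seteqP; split => y /=; rewrite E.
  by case: asboolP => DBy <-.
case: eqP => [->|_]; first by move=> h; rewrite asboolT.
by case: eqP => [->|//] h; rewrite asboolF.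
Qed.

Context dO {O : measurableType dO} (P : probability O R) (n : nat).
Variables (X : 'I_n -> {RV P >-> V}) (Q : probability V R).
Hypothesis X_indep : mutually_independent X.
Hypothesis X_law : forall i B, measurable B -> P (X i @^-1` B) = Q B.

Lemma pair_law i j : i != j -> forall C, measurable C ->
  P ((fun w => (X i w, X j w)) @^-1` C) = (Q \x Q)%E C.
Proof.
move=> ij C mC; rewrite -[LHS]/(P _) -[_ @^-1` _]setIT.
rewrite (@joint_law_prod _ _ _ _ _ _ _ P Q Q)//.
  by rewrite [X in (_ * X)%E]probability_setT mule1.
move=> A B mA mB.
rewrite [X in (_ * X)%E]probability_setT mule1 setIT.
have := @X_indep [set i; j]%SET (fun k => if k == i then A else B).
rewrite big_setU1/= ?big_set1 ?inE// eqxx eq_sym (negbTE ij) !X_law// => <-.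
  congr (P _); apply/seteqP; split => [w [Aw Bw] k|w h]/=.
    by rewrite !inE => /orP[] /eqP ->; rewrite ?eqxx// eq_sym (negbTE ij).
  split; [have := h i|have := h j]; rewrite /= !inE ?eqxx ?orbT//= => /(_ isT)//.
  by rewrite eq_sym (negbTE ij).
by move=> k; case: ifP.
Qed.

Variable D : set V.
Hypothesis mD : measurable D.

(** Indexed by a list of coordinates, to be taken off one by one in an induction; [enum 'I_n] gives
    the whole sample. *)
Definition sample_config (r : seq 'I_n) (w : O) : config :=
  restrict D [seq X i w | i <- r].

Lemma sample_config_cons i r w :
  sample_config (i :: r) w = restrict D [:: X i w] ++ sample_config r w.
Proof. by rewrite /sample_config /restrict /=; case: ifP. Qed.

Lemma measurable_sample_config r : measurable_fun setT (sample_config r).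
Proof.
elim: r => [|i r IH]; first exact: measurable_cst.
rewrite (_ : sample_config _ = @config_cat R d \o
   (fun w => (restrict D [:: X i w], sample_config r w))); last first.
  by apply/funext => w; rewrite sample_config_cons.
apply: measurableT_comp; first exact: measurable_config_cat.
apply: measurable_fun_pair => //.
exact: (measurableT_comp (measurable_singleton mD)).
Qed.

Let law1 : probability config R := law Q (measurable_singleton mD).

(* The event on the coordinates outside [r] is carried along so that the
   induction on [r] can move an index from [J] to [r]. *)
Lemma sample_config_law_indep (r : seq 'I_n) (J : {set 'I_n}) (B : 'I_n -> set V) A :
  uniq r -> {in r, forall i, i \notin J} -> measurable A ->
  (forall i, measurable (B i)) ->
  P (sample_config r @^-1` A `&` \bigcap_(i in [set` J]) X i @^-1` B i) =
  (conv_pow law1 (size r) A * P (\bigcap_(i in [set` J]) X i @^-1` B i))%E.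
Proof.
elim: r J B A => [|j r IH] J B A /=.
  move=> _ _ mA mB; rewrite diracE.
  case: (pselect (A [::])) => A0.
    rewrite mem_set// mul1e; congr (P _).
    by apply/seteqP; split => [w []//|w].
  rewrite memNset// mul0e (_ : _ `&` _ = set0) ?measure0//.
  by rewrite -subset0 => w [].
move=> /andP[jr ur] rJ mA mB.
set E := \bigcap_(i in _) _.
have jJ : j \notin J by apply: rJ; rewrite inE eqxx.
have mE : measurable E.
  apply: fin_bigcap_measurable => // i _.
  by rewrite -[X in measurable X]setTI; exact: measurable_funP.
rewrite (_ : sample_config (j :: r) @^-1` A =
  (fun w => (restrict D [:: X j w], sample_config r w)) @^-1`
     (@config_cat R d @^-1` A)); last first.
  by apply/seteqP; split => w /=; rewrite /preimage/= sample_config_cons.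
rewrite (@joint_law_prod _ _ _ _ _ _ _ P law1 (conv_pow law1 (size r)))//.
- exact: (measurableT_comp (measurable_singleton mD)).
- exact: measurable_sample_config.
- move=> A1 A2 mA1 mA2.
  pose C := (fun y => restrict D [:: y]) @^-1` A1.
  have mC : measurable C.
    by rewrite -[X in measurable X]setTI; exact: measurable_singleton.
  (* What is asked of the one-point configuration of [X j] is the event that [X j] lies in [C];
     recorded at index [j], it joins the events carried by [J]. *)
  pose B' i := if i == j then C else B i.
  have mB' i : measurable (B' i) by rewrite /B'; case: ifP.
  have EB' : \bigcap_(i in [set` J]) X i @^-1` B' i = E.
    apply: eq_bigcapr => i /= iJ; rewrite /B'; case: eqP => // ij.
    by rewrite -ij iJ in jJ.
  have JE : \bigcap_(i in [set` (j |: J)%SET]) X i @^-1` B' i =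
      (X j @^-1` C) `&` E.
    rewrite -EB'; apply/seteqP; split => [w h|w [Cw h] i /=].
      split; first by have := h j; rewrite /= !inE /B' eqxx => /(_ isT).
      by move=> i iJ; apply: h; rewrite /= !inE; apply/orP; right.
    by rewrite !inE => /orP[/eqP ->|/h//]; rewrite /B' eqxx.
  have := IH (j |: J)%SET B' A2 ur _ mA2 mB'.
  rewrite !JE => h.
  rewrite -setIA setICA setIA setIAC [X in P X](_ : _ =
    sample_config r @^-1` A2 `&` ((X j @^-1` C) `&` E)); last first.
    by apply/seteqP; split => w /=; [move=> [[? ?] ?]|move=> [? [? ?]]].
  rewrite h; last first.
    move=> i ir; rewrite !inE negb_or rJ ?andbT ?inE ?ir ?orbT//.
    by apply: contraNneq jr => <-.
  rewrite -JE X_indep// big_setU1//= [in B' j]/B' eqxx X_law// -EB' X_indep//.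
  by rewrite muleA [X in (X * _)%E]muleC.
- by rewrite -[X in measurable X]setTI; exact: measurable_config_cat.
Qed.

Lemma sample_config_law A : measurable A ->
  P (sample_config (enum 'I_n) @^-1` A) = conv_pow law1 n A.
Proof.
move=> mA.
have := @sample_config_law_indep (enum 'I_n) finset.set0 (fun=> setT) A.
rewrite enum_uniq size_enum_ord => /(_ isT).
rewrite (_ : \bigcap_(i in _) _ = setT); last first.
  by apply/seteqP; split.
rewrite setIT probability_setT mule1; apply => //.
by move=> i _; rewrite inE.
Qed.

End sample.

(** * Absence of ties in the sample *)

Section diffuse.
Context {R : realType} {d : nat}.
Local Notation V := 'rV[R]_d.

Lemma measurable_box (B : 'I_d -> set R) : (forall i, measurable (B i)) ->
  measurable [set v : V | forall i, B i (v 0 i)].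
Proof.
move=> mB; rewrite (_ : [set _ | _] = \bigcap_(i in [set: 'I_d])
     (rV_coord i @^-1` B i)); last first.
  by apply/seteqP; split => [v h i _|v h i]; exact: h.
apply: fin_bigcap_measurable => // i _.
by rewrite -[X in measurable X]setTI; exact: measurable_rV_coord.
Qed.

Lemma set1_boxE (y : V) : [set y] = [set v : V | forall i, [set y 0 i] (v 0 i)].
Proof. by apply/seteqP; split => [_ -> //|v h]; apply/rowP => i; exact: h. Qed.

Lemma measurable_set1_rV (y : V) : measurable [set y].
Proof.
rewrite set1_boxE.
exact: (measurable_box (fun i => measurable_set1 (y 0 i))).
Qed.

Lemma lebesgue_rV_set1 (y : V) : (0 < d)%N -> lebesgue_rV d [set y] = 0%E.
Proof.
move=> d0; rewrite set1_boxE (lebesgue_rV_box (fun i => measurable_set1 (y 0 i))).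
case: d d0 y => // d' _ y.
by rewrite big_ord_recl [X in (X * _)%E]lebesgue_measure_set1 mul0e.
Qed.

Lemma measurable_diagonal : measurable [set p : V * V | p.1 = p.2].
Proof.
rewrite (_ : [set _ | _] =
  \bigcap_(i in [set: 'I_d]) [set p : V * V | p.1 0 i = p.2 0 i]); last first.
  apply/seteqP; split => [p /= pE i _|p h]; first by rewrite /= pE.
  by apply/rowP => i; exact: h.
apply: fin_bigcap_measurable => // i _.
rewrite (_ : [set _ | _] =
    (fun p : V * V => rV_coord i p.1 - rV_coord i p.2) @^-1` [set 0]).
  rewrite -[X in measurable X]setTI; apply: measurable_funB => //.
    exact: (measurableT_comp (measurable_rV_coord i) measurable_fst).
  exact: (measurableT_comp (measurable_rV_coord i) measurable_snd).
apply/seteqP; split => p /=; first by rewrite /rV_coord => ->; rewrite subrr.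
by move/eqP; rewrite subr_eq0 => /eqP.
Qed.

Lemma diagonal_null (Q : probability V R) : (forall y, Q [set y] = 0%E) ->
  (Q \x Q)%E [set p | p.1 = p.2] = 0%E.
Proof.
move=> Q0; rewrite /product_measure1; apply: integral0_eq => y _ /=.
rewrite (_ : xsection _ _ = [set y]) ?Q0//.
by apply/seteqP; split => z; rewrite /xsection/= inE/=.
Qed.

Context dO {O : measurableType dO} (P : probability O R) (n : nat).
Variables (X : 'I_n -> {RV P >-> V}) (Q : probability V R).
Hypothesis X_indep : mutually_independent X.
Hypothesis X_law : forall i B, measurable B -> P (X i @^-1` B) = Q B.
Hypothesis Q_diffuse : forall y, Q [set y] = 0%E.

Let noties := \bigcap_(k in [set k : 'I_n * 'I_n | k.1 != k.2])
  [set w | X k.1 w <> X k.2 w].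

Let tie_preim k : ~` [set w | X k.1 w <> X k.2 w] =
  (fun w => (X k.1 w, X k.2 w)) @^-1` [set p | p.1 = p.2].
Proof. by apply/seteqP; split => w /=; [move/contrapT|move=> h; apply]. Qed.

Let measurable_tie k : measurable (~` [set w | X k.1 w <> X k.2 w]).
Proof.
rewrite tie_preim -[X in measurable X]setTI.
by apply: (measurable_fun_pair _ _ measurableT measurable_diagonal).
Qed.

(** A union bound over pairs of indices: a tie is the event that an independent pair hits the
    diagonal, which is null by Fubini because its sections are points. *)
Lemma sample_distinct : exists F : set O, [/\ measurable F, P F = 1%E &
  forall w, F w -> injective (fun i => X i w)].
Proof.
have mF : measurable noties.
  apply: fin_bigcap_measurable => [|k _]; first exact: finite_finset.
  by rewrite -[X in measurable X]setCK; apply: measurableC.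
exists noties; split => // [|w h i j /= ij]; last first.
  by apply: contrapT => /eqP nij; exact: (h (i, j) nij).
suff PF0 : P (~` noties) = 0%E.
  by rewrite -[noties]setCK probability_setC ?PF0 ?sube0//; exact: measurableC.
apply/eqP; rewrite eq_le measure_ge0 andbT.
apply: (@le_trans _ _ (\sum_(k \in [set k : 'I_n * 'I_n | k.1 != k.2])
    P (~` [set w | X k.1 w <> X k.2 w]))%E).
  apply: content_sub_fsum => //; first exact: finite_finset.
    exact: measurableC.
  by rewrite -setC_bigcap.
rewrite fsbig1// => -[i j] /= ij.
rewrite (tie_preim (i, j)) (pair_law X_indep X_law ij) ?diagonal_null//.
exact: measurable_diagonal.
Qed.

End diffuse.

(** * One point against one unit of intensity *)

Section density.
Context {R : realType} {d : nat}.
Local Notation V := 'rV[R]_d.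
Variables (f : V -> R) (c e : R) (D : set V).
Hypotheses (mf : measurable_fun setT f) (f_ge0 : forall y, 0 <= f y).
Hypotheses (c_ge0 : 0 <= c) (mD : measurable D).
Hypothesis osc : (\int[lebesgue_rV d]_(u in D) `|f u - c|%:E <= e%:E)%E.

Let mfc B : measurable_fun B (fun u => `|f u - c|%:E).
Proof.
apply: measurable_funTS; apply/measurable_EFinP.
by apply: measurableT_comp => //; exact: measurable_funB.
Qed.

Let sub_osc B : measurable B -> B `<=` D ->
  (\int[lebesgue_rV d]_(u in B) `|f u - c|%:E <= e%:E)%E.
Proof.
move=> mB BD; apply: le_trans osc.
by apply: ge0_subset_integral => // u _; rewrite lee_fin.
Qed.

(** Integrate [f u <= |f u - c| + c]; the lower bound below comes from exchanging [f u] and [c]. *)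
Lemma density_upper B : measurable B -> B `<=` D ->
  (\int[lebesgue_rV d]_(u in B) (f u)%:E <= e%:E + c%:E * lebesgue_rV d B)%E.
Proof.
move=> mB BD; rewrite -(integral_cst _ mB).
apply: le_trans (leeD2r _ (sub_osc mB BD)).
rewrite -ge0_integralD//=.
apply: ge0_le_integral => //=.
- by move=> u _; rewrite lee_fin.
- by apply: measurable_funTS; exact/measurable_EFinP.
- exact: emeasurable_funD.
- by move=> u _; rewrite -EFinD lee_fin -lerBlDr ler_norm.
Qed.

Lemma density_lower : (c%:E * lebesgue_rV d D <=
  e%:E + \int[lebesgue_rV d]_(u in D) (f u)%:E)%E.
Proof.
have mfD : measurable_fun D (fun u => (f u)%:E).
  by apply: measurable_funTS; exact/measurable_EFinP.
rewrite -(integral_cst _ mD).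
apply: le_trans (leeD2r _ osc).
rewrite -ge0_integralD//=.
apply: ge0_le_integral => //=.
- exact: emeasurable_funD.
- by move=> u _; rewrite -EFinD lee_fin -lerBlDr distrC ler_norm.
- by move=> u _; rewrite lee_fin.
Qed.

End density.

Section single_point.
Context {R : realType} {d : nat} dO {O : measurableType dO}.
Local Notation V := 'rV[R]_d.
Local Notation config := (config R d).
Variables (P : probability O R) (c : R) (Phi : O -> set V).
Hypothesis Phi_poisson : poisson_process P c Phi.
Variable D : set V.
Hypotheses (mD : measurable D) (bD : bounded_set D).
Hypothesis tD : 0 < c * fine (lebesgue_rV d D).
Variables (f : V -> R) (Q : probability V R) (e : R).
Hypotheses (mf : measurable_fun setT f) (f_ge0 : forall y, 0 <= f y).
Hypothesis c_gt0 : 0 < c.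
Hypothesis Q_density : forall B, measurable B ->
  Q B = (\int[lebesgue_rV d]_(u in B) (f u)%:E)%E.
Hypothesis osc : (\int[lebesgue_rV d]_(u in D) `|f u - c|%:E <= e%:E)%E.

Let t := c * fine (lebesgue_rV d D).
Let kappa w := points (Phi w `&` D).
Let mkappa := measurable_points Phi_poisson mD.
Let kappa_law := process_poisson_counts Phi_poisson mD bD tD.

Let restrictE y : restrict D [:: y] = if `[< D y >] then [:: y] else [::].
Proof. by rewrite /restrict /=. Qed.

Let subD w : count_in D (kappa w) = size (kappa w).
Proof.
apply/eqP; rewrite -all_count; apply/allP => y.
have [fw|nfw] := pselect (finite_set (Phi w `&` D)).
  by rewrite mem_points// inE => -[_ Dy]; apply/asboolP.
by rewrite /kappa points_infinite.
Qed.

(** On the Poisson side only configurations with at most one point are kept, which gives a lower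
    bound. With [a] the volume of the admissible points [A1], one has [q <= e + c a] and
    [c a (1 - expR (- t)) <= t ^ 2]; the empty configuration adds a second [e], from
    [1 - p <= 1 - t + e <= expR (- t) + e]. *)
Lemma tv_le_single_point :
  tv_le (law Q (measurable_singleton mD)) (law P mkappa) (2 * e + t ^+ 2).
Proof.
move=> A mA.
change (Q ((fun y => restrict D [:: y]) @^-1` A) <=
  P (kappa @^-1` A) + (2 * e + t ^+ 2)%:E)%E.
pose A1 := D `&` (fun y => restrict D [:: y]) @^-1` A.
have mA1 : measurable A1.
  apply: measurableI => //; rewrite -[X in measurable X]setTI.
  exact: measurable_singleton.
have A1D : A1 `<=` D by move=> y [].
have lamD : lebesgue_rV d D \is a fin_num.
  move: tD; case: (lebesgue_rV d D) => [r//||]; by rewrite /= mulr0 ltxx.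
have lamA1 : lebesgue_rV d A1 \is a fin_num.
  rewrite ge0_fin_numE ?measure_ge0//.
  apply: (@le_lt_trans _ _ (lebesgue_rV d D)); first by apply: le_measure; rewrite ?inE.
  by rewrite -ge0_fin_numE ?measure_ge0.
pose a := fine (lebesgue_rV d A1).
pose q := fine (Q A1); pose p := fine (Q D).
have a0 : 0 <= a by rewrite fine_ge0.
have aD : c * a <= t.
  rewrite ler_pM2l// fine_le//; apply: le_measure; rewrite ?inE//.
have qA1 : Q A1 = q%:E by rewrite fineK// fin_num_measure.
have pD : Q D = p%:E by rewrite fineK// fin_num_measure.
have qe : q <= e + c * a.
  rewrite -lee_fin -qA1 EFinD EFinM fineK// Q_density//.
  exact: (density_upper mf f_ge0 (ltW c_gt0) mD osc).
have te : t <= e + p.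
  rewrite -lee_fin /t EFinM fineK// EFinD -pD Q_density//.
  exact: (density_lower mf f_ge0 (ltW c_gt0) mD osc).
have e0 : 0 <= e.
  by rewrite -lee_fin; apply: le_trans osc; apply: integral_ge0 => u _; rewrite lee_fin.
(* Exactly one Poisson point in [D], and it lies in [A1]: [nat_of_bool] prescribes 1 in [A1] and 0
   in the rest of [D]. *)
pose E1 := kappa @^-1` [set s | forall b : bool,
   count_in (if b then A1 else D `\` A1) s = nat_of_bool b].
have mDA1 : measurable (D `\` A1) by exact: measurableD.
have tE1 : trivIset setT (fun b : bool => if b then A1 else D `\` A1).
  by move=> [] [] _ _ [y []]// => [h []|[_ ?]]//.
have PE1 : P E1 = (c * a * expR (- t))%:E.
  have mB (b : bool) : measurable (if b then A1 else D `\` A1) by case: b.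
  have E1E := kappa_law nat_of_bool mB tE1.
  rewrite [LHS]E1E big_bool/= /pois expr1 expr0.
  have f1 : 1`!%:R = 1 :> R by [].
  have tE : t = c * a + c * fine (lebesgue_rV d (D `\` A1)).
    rewrite /t -mulrDr -fineD//.
      rewrite [X in fine X](measureDI _ mD mA1) (setIidr A1D) addrC//.
    rewrite ge0_fin_numE ?measure_ge0//.
    apply: (@le_lt_trans _ _ (lebesgue_rV d D)).
      by apply: le_measure; rewrite ?inE//; exact: subDsetl.
    by rewrite -ge0_fin_numE ?measure_ge0.
  rewrite !f1 (setIidr A1D) setIDA setIid tE opprD expRD; congr _%:E.
  by rewrite !divr1 mul1r mulrA.
have mU (u : unit) : measurable D by [].
have PE0 : P (kappa @^-1` [set s | forall u : unit, count_in D s = 0%N]) =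
    (expR (- t))%:E.
  have E0E := kappa_law (fun=> 0%N) mU.
  rewrite [LHS]E0E; last by move=> [] [].
  by rewrite big_const/= card_unit/= /pois expr0 fact0 divr1 !mul1r mulr1 setIid.
set E0 := _ @^-1` _ in PE0.
have mkappaE B : measurable B -> measurable (kappa @^-1` B).
  by move=> mB; rewrite -[X in measurable X]setTI; exact: mkappa.
have mE0 : measurable E0 by apply: mkappaE; exact: measurable_count_vec.
have mE1 : measurable E1.
  by apply: mkappaE; apply: measurable_count_vec => -[].
have mkA := mkappaE A mA.
have E0nil w : E0 w -> kappa w = [::].
  by move=> /(_ tt) /= h; apply: size0nil; rewrite -subD.
have E1A : E1 `<=` kappa @^-1` A.
  move=> w E1w; have /= h1 := E1w true; have /= h0 := E1w false.
  have : size (kappa w) = 1%N.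
    rewrite -subD -[RHS]/(1 + 0)%N -h1 -h0 /count_in -count_predUI.
    rewrite [X in (_ + X)%N](@eq_count _ _ pred0) ?count_pred0 ?addn0.
      apply: eq_count => y /=; apply/asboolP/orP => [Dy|].
        by have [?|?] := pselect (A1 y); [left|right]; apply/asboolP.
      by case=> /asboolP => [/A1D|[]].
    by move=> y /=; apply/negP => /andP[/asboolP A1y /asboolP[_ /(_ A1y)]].
  move: h1; rewrite /preimage /=; case: (kappa w) => [//|y [|//]] + _.
  rewrite /count_in /= addn0; case: asboolP => // -[Dy].
  by rewrite -[X in X -> _]/(A (restrict D [:: y])) restrictE asboolT.
have ex1 := expR_ge1Dx (- t).
have x0 := expR_gt0 (- t).
have x1 : expR (- t) <= 1 by rewrite -expR0 ler_expR oppr_le0 ltW.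
have ca0 : 0 <= c * a by rewrite mulr_ge0// ltW.
have main : q - c * a * expR (- t) <= e + t ^+ 2.
  have : c * a * (1 - expR (- t)) <= t * t.
    by apply: ler_pM => //; [rewrite subr_ge0|lra].
  by rewrite expr2; lra.
(* A sample point outside [D] yields the empty configuration, so it counts only if [A] contains that
   configuration. *)
have [A0|nA0] := pselect (A [::]).
- apply: (@le_trans _ _ (q%:E + (1 - p%:E))%E).
    rewrite -qA1 -pD -probability_setC//.
    apply: le_trans (measureU2 _ mA1 (measurableC mD)).
    apply: le_measure; rewrite ?inE.
    + by rewrite -[X in measurable X]setTI; exact: measurable_singleton.
    + by apply: measurableU => //; exact: measurableC.
    + move=> y yA; have [Dy|nDy] := pselect (D y); last by right.
      by left; split.
  apply: (@le_trans _ _ (P (E0 `|` E1) + (2 * e + t ^+ 2)%:E)%E).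
    have -> : P (E0 `|` E1) = (expR (- t) + c * a * expR (- t))%:E.
      rewrite EFinD -PE1 -PE0; apply: measureU => //.
      by rewrite -subset0 => w [/E0nil kw /(_ true) /=]; rewrite kw.
    by rewrite -!EFinD lee_fin; lra.
  apply: leeD2r; apply: le_measure; rewrite ?inE//; first exact: measurableU.
  by move=> w [/E0nil kw|/E1A//]; rewrite /preimage/= kw.
- apply: (@le_trans _ _ q%:E).
    rewrite -qA1; apply: le_measure; rewrite ?inE//.
      by rewrite -[X in measurable X]setTI; exact: measurable_singleton.
    move=> y yA; have [Dy|nDy] := pselect (D y); first by split.
    by move: yA; rewrite -[X in X -> _]/(A (restrict D [:: y])) restrictE asboolF.
  apply: (@le_trans _ _ (P E1 + (2 * e + t ^+ 2)%:E)%E).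
    by rewrite PE1 -!EFinD lee_fin; lra.
  by apply: leeD2r; apply: le_measure; rewrite ?inE.
Qed.

End single_point.

(** * From the functional to an event of configurations *)

(* Measurability with respect to the process is used on its canonical
   realization, whose sample space is the type of all sets: this yields one
   event of configurations that serves every process and every sample. *)
Lemma process_event (R : realType) (d : nat) (L : R) (x : 'rV[R]_d)
    (G : polytope R d -> R) dO (O : measurableType dO) (P : probability O R)
    (Phi : O -> set 'rV[R]_d) :
  process_measurable L x G -> poisson_process P L Phi ->
  forall z, exists2 A : set (config R d), measurable A &
    forall s, uniq s -> A s <-> G (voronoi_cell (x |` [set` s]) x) <= z.
Proof.
move=> GP [cPhi mPhi fdd] z.
(* A Poisson process must have countable values everywhere, so uncountable sets are read as
   empty. *)
pose Psi (S : set 'rV[R]_d) := if `[< countable S >] then S else set0.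
pose gen := \bigcup_(B in @measurable _ 'rV[R]_d)
  preimage_set_system setT (fun S => counting (Psi S `&` B) : \bar R) measurable.
pose T := g_sigma_algebraType gen.
have PsiE S : countable S -> Psi S = S by move=> cS; rewrite /Psi asboolT.
have mPhiT : measurable_fun setT (Phi : O -> T).
  apply: (@measurability _ _ O T setT Phi gen) => //.
  move=> _ [_ [B mB [Y mY <-]] <-]; rewrite !setTI.
  rewrite (_ : _ @^-1` _ = num_points Phi B @^-1` Y).
    by rewrite -[X in measurable X]setTI; exact: (mPhi _ mB).
  by apply/seteqP; split => w; rewrite /preimage/= /num_points PsiE.
have Psi_poisson : poisson_process (law P mPhiT) L (Psi : T -> _).
  split.
  - by move=> S; rewrite /Psi; case: asboolP => // _; exact: countable0.
  - by move=> B mB _ Y mY; apply: sub_sigma_algebra; exists B => //; exists Y.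
  - move=> k B m k0 mB bB tB; rewrite -fdd//; congr (P _).
    by apply/seteqP; split => w /= h i; have := h i; rewrite /num_points PsiE.
have := GP _ _ _ _ Psi_poisson.
pose g (S : T) := G (process_cell x (Psi : T -> _) S).
move=> /(_ (g @^-1` `]-oo, z]%classic)) hg.
have {hg} : <<s gen >> (g @^-1` `]-oo, z]%classic).
  by apply: hg; exists `]-oo, z]%classic => //; rewrite setTI.
(* The sets that have a counterpart among configurations without repetitions form a sigma-algebra,
   and the generators belong to it. *)
have sub : <<s gen >> `<=` [set C : set T | exists2 A : set (config R d),
    measurable A & forall s : config R d, uniq s -> A s <-> C [set` s]].
  apply: smallest_sub.
    split.
    - by exists set0.
    - move=> C [A mA AC]; exists (~` A); first exact: measurableC.
      by move=> s us; rewrite setTD; split; apply: contra_not => /(AC s us).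
    - move=> F FP; have /choice[A mA] n : exists A : set (config R d),
          measurable A /\ forall s : config R d, uniq s -> A s <-> F n [set` s].
        by have [A ? ?] := FP n; exists A.
      exists (\bigcup_n A n); first by apply: bigcup_measurable => n _; exact: (mA n).1.
      move=> s us; split=> -[n _ h]; exists n => //; exact/((mA n).2 s us).
  move=> _ [B mB [Y mY <-]].
  exists (count_in B @^-1` [set n : nat | Y n%:R%:E]).
    by rewrite -[X in measurable X]setTI; exact: measurable_count.
  move=> s us; rewrite setTI /preimage /= /num_points PsiE ?counting_seq//.
  by apply: finite_set_countable; exact: finite_seq.
move=> /sub [A mA AC]; exists A => // s us.
rewrite (AC s us) /preimage /= in_itv /= /g /process_cell PsiE//.
by apply: finite_set_countable; exact: finite_seq.
Qed.

(** * Locality of the cell *)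

Section geometry.
Context {R : realType} {d : nat}.
Local Notation V := 'rV[R]_d.
Variables (x : V) (t : R).
Hypotheses (d_gt0 : (0 < d)%N) (t_gt0 : 0 < t).

Definition cube (r : R) : set V :=
  [set v | forall i, `]x 0 i - r, x 0 i + r[%classic (v 0 i)].

(** [sigma] lists the coordinates with positive offset from [x]. Offsets beyond [t] bound inner
    products from below; offsets within [2 t] bound the distance to [x]. *)
Definition corner (sigma : {set 'I_d}) : set V :=
  [set v | forall i, (if i \in sigma then `]x 0 i + t, x 0 i + 2 * t[%classic
    else `]x 0 i - 2 * t, x 0 i - t[%classic) (v 0 i)].

Lemma corner_sub_cube sigma : corner sigma `<=` cube (4 * d%:R * t).
Proof.
have d1 : (1 : R) <= d%:R by rewrite ler1n.
have : t <= d%:R * t by rewrite ler_peMl// ltW.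
rewrite /cube -mulrA; move: (d%:R * t) => e dt v h i.
have := h i; rewrite /= in_itv/=; have := t_gt0.
by case: ifP => _ /=; rewrite !in_itv/= => ? /andP[? ?]; apply/andP; split; lra.
Qed.

Let enorm_le (p s : V) : (enorm (p - x) <= enorm (p - s)) =
  (dotrV (p - x) (s - x) *+ 2 <= dotrV (s - x) (s - x)).
Proof.
rewrite /enorm ler_sqrt; last by apply: sumr_ge0 => i _; rewrite -expr2 sqr_ge0.
rewrite (_ : p - s = (p - x) - (s - x)); last first.
  by rewrite opprB addrA subrK.
have -> : dotrV (p - x) (s - x) = dotrV (s - x) (p - x).
  by apply: eq_bigr => i _; rewrite mulrC.
by rewrite [X in _ <= X]dotrVB; apply/idP/idP; lra.
Qed.

(* The points found in the corners force the cell of [x] into the l1-ball of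
   radius [2 d t], whose points are closer to [x] than to any point outside
   the cube. *)
Lemma voronoi_set_local (S : set V) :
  (forall sigma, S `&` corner sigma !=set0) ->
  voronoi_set (x |` S) x = voronoi_set (x |` (S `&` cube (4 * d%:R * t))) x.
Proof.
move=> corS; apply/seteqP; split => p pS s' [].
  move=> [->//|[Ss' _] s'x]; apply: pS; split => //; by right.
move=> xSs' s'x; have [cs'|ncs'] := pselect (cube (4 * d%:R * t) s').
  by apply: pS; split => //; case: xSs' => [->|?]; [left|right].
have {xSs'}Ss' : S s' by case: xSs'.
pose u := p - x.
have u1 : \sum_i `|u 0 i| <= 2 * d%:R * t.
  (* The corner in the orthant of [u], where every term of the inner product with [u] is
     nonnegative. *)
  pose sigma := [set i | 0 <= u 0 i]%SET.
  have [s [Ss cs]] := corS sigma.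
  have sE i : `|u 0 i| * t <= u 0 i * (s - x) 0 i /\ ((s - x) 0 i) ^+ 2 <= 4 * t ^+ 2.
    have -> : (s - x) 0 i = s 0 i - x 0 i by rewrite !mxE.
    have := cs i; rewrite inE; case: ifP => ui; rewrite /= in_itv/= => /andP[? ?].
      split; first by rewrite ger0_norm// ler_wpM2l//; lra.
      by rewrite (_ : 4 * t ^+ 2 = (2 * t) ^+ 2); [rewrite ler_sqr ?nnegrE//; lra|ring].
    split.
      have u0 : u 0 i < 0 by rewrite ltNge ui.
      by rewrite ltr0_norm// mulNr -mulrN; apply: ler_wnM2l; [exact: ltW|lra].
    rewrite -sqrrN (_ : 4 * t ^+ 2 = (2 * t) ^+ 2); last by ring.
    by rewrite ler_sqr ?nnegrE//; lra.
  have : enorm (p - x) <= enorm (p - s).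
    apply: pS; split; first by right; split => //; exact: corner_sub_cube cs.
    (* The nucleus is in no corner, as any one coordinate shows. *)
    move=> /= sx; have := cs (Ordinal d_gt0); rewrite sx.
    by case: ifP => _; rewrite /= in_itv/= => /andP[]; lra.
  rewrite enorm_le => h.
  (* With [S1] the l1-norm of [u]: [S1 t <= dotrV u (s - x) <= dotrV (s - x) (s - x) / 2 <= 2 d t ^
     2]. *)
  have uv : (\sum_i `|u 0 i|) * t <= dotrV (p - x) (s - x).
    rewrite /dotrV mulr_suml; apply: ler_sum => i _; exact: (sE i).1.
  have vv : dotrV (s - x) (s - x) <= d%:R * (4 * t ^+ 2).
    rewrite (_ : _ * _ = \sum_(i < d) 4 * t ^+ 2); last first.
      by rewrite sumr_const card_ord mulr_natl.
    apply: ler_sum => i _.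
    by rewrite -expr2; exact: (sE i).2.
  by rewrite -(ler_pM2r t_gt0); lra.
rewrite enorm_le.
(* The sup norm [m] of [v] is at least [4 d t], so [dotrV u v <= 2 d t m <= m ^ 2 / 2 <= dotrV v v /
   2]. *)
pose v := s' - x; rewrite -/v -/u.
case: (@Order.TotalTheory.arg_maxP _ _ _ (Ordinal d_gt0) predT
  (fun i => `|v 0 i|)) => // j _ jmax.
set m := `|v 0 j| in jmax.
have m_ge : 4 * d%:R * t <= m.
  rewrite leNgt; apply/negP => mlt; apply: ncs' => i.
  have /(_ isT) vi := jmax i; rewrite /= in_itv/=.
  have : `|v 0 i| < 4 * d%:R * t by exact: le_lt_trans mlt.
  by rewrite /v !mxE ltr_norml => /andP[? ?]; apply/andP; split; lra.
have uv : dotrV u v <= 2 * d%:R * t * m.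
  apply: (@le_trans _ _ ((\sum_i `|u 0 i|) * m)); last first.
    by apply: ler_wpM2r => //; exact: normr_ge0.
  rewrite /dotrV mulr_suml; apply: ler_sum => i _.
  by rewrite (le_trans (ler_norm _))// normrM ler_wpM2l//; exact: jmax.
have vv : m ^+ 2 <= dotrV v v.
  rewrite /dotrV (bigD1 j)//= -expr2 real_normK ?num_real// lerDl.
  by apply: sumr_ge0 => i _; rewrite -expr2 sqr_ge0.
have : 4 * d%:R * t * m <= m * m by apply: ler_wpM2r => //; exact: normr_ge0.
by rewrite -expr2 mulr2n; lra.
Qed.

(** [G] takes a set together with a proof of polytopality, so equality is needed in the subset
    type. *)
Lemma voronoi_cell_local (S : set V) :
  (forall sigma, S `&` corner sigma !=set0) ->
  voronoi_cell (x |` S) x = voronoi_cell (x |` (S `&` cube (4 * d%:R * t))) x.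
Proof.
by move=> corS; apply: eq_exist; exact: voronoi_set_local.
Qed.

End geometry.

(** * Cubes, balls and Lebesgue points *)

Section cube_measure.
Context {R : realType} {d : nat}.
Local Notation V := 'rV[R]_d.
Variables (x : V).

Lemma measurable_cube r : measurable (cube x r).
Proof. exact: (measurable_box (fun i => measurable_itv _)). Qed.

Lemma measurable_corner t sigma : measurable (corner x t sigma).
Proof.
apply: (@measurable_box _ _ (fun i => if i \in sigma then
  `]x 0 i + t, x 0 i + 2 * t[%classic else `]x 0 i - 2 * t, x 0 i - t[%classic)).
by move=> i; case: ifP.
Qed.

Lemma lebesgue_rV_cube r : 0 < r ->
  lebesgue_rV d (cube x r) = ((2 * r) ^+ d)%:E.
Proof.
move=> r0; rewrite (lebesgue_rV_box (fun i => measurable_itv _)).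
rewrite (eq_bigr (fun=> (2 * r)%:E)).
  by rewrite prodEFin prodr_const card_ord.
move=> i _; rewrite lebesgue_measure_itv/= lte_fin ltrBlDr -addrA ltrDl.
by rewrite addr_gt0// -EFinD; congr _%:E; ring.
Qed.

Lemma lebesgue_rV_corner t sigma : 0 < t ->
  lebesgue_rV d (corner x t sigma) = (t ^+ d)%:E.
Proof.
move=> t0; rewrite /corner (lebesgue_rV_box (B := fun i => if i \in sigma then
  `]x 0 i + t, x 0 i + 2 * t[%classic else `]x 0 i - 2 * t, x 0 i - t[%classic));
  last by move=> i; case: ifP.
rewrite (eq_bigr (fun=> t%:E)).
  by rewrite prodEFin prodr_const card_ord.
move=> i _; case: ifP => _; rewrite lebesgue_measure_itv/= lte_fin.
  by rewrite ifT; [rewrite -EFinD; congr _%:E; ring|lra].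
by rewrite ifT; [rewrite -EFinD; congr _%:E; ring|lra].
Qed.

Lemma bounded_cube r : 0 < r -> bounded_set (cube x r).
Proof.
move=> r0; exists (`|x| + r); split; first by rewrite num_real.
move=> M xM v vc /=; rewrite (le_trans _ (ltW xM))//.
have : ball x r v.
  split => // i j; rewrite ord1; have := vc j; rewrite /= in_itv/= => /andP[? ?].
  by rewrite /ball/= ltr_norml; apply/andP; split; lra.
rewrite -ball_normE/= => xv; rewrite -[v](subrK x) addrC.
by rewrite (le_trans (ler_normD _ _))// lerD2l distrC ltW.
Qed.

Lemma dotrV_ge0 (v : V) : 0 <= dotrV v v.
Proof. by apply: sumr_ge0 => i _; rewrite -expr2 sqr_ge0. Qed.

Lemma enorm_lt (v : V) r : 0 < r -> (enorm v < r) = (dotrV v v < r ^+ 2).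
Proof.
by move=> r0; rewrite /enorm -(ltr_sqr (sqrtr_ge0 _) (ltW r0)) sqr_sqrtr ?dotrV_ge0.
Qed.

Lemma measurable_eball r : 0 < r -> measurable (eball x r).
Proof.
move=> r0; rewrite (_ : eball x r =
  (fun v : V => \sum_(i < d) (rV_coord i v - x 0 i) ^+ 2) @^-1` `]-oo, r ^+ 2[).
  rewrite -[X in measurable X]setTI; apply: measurable_sum => // i.
  apply: measurable_funX; apply: measurable_funB => //.
  exact: measurable_rV_coord.
have E v : dotrV (v - x) (v - x) = \sum_(i < d) (rV_coord i v - x 0 i) ^+ 2.
  by apply: eq_bigr => i _; rewrite !mxE -expr2.
by apply/seteqP; split => v; rewrite /eball /preimage/= enorm_lt// in_itv/= E.
Qed.

Lemma eball_sub_cube r : 0 < r -> eball x r `<=` cube x r.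
Proof.
move=> r0 v; rewrite /eball/= enorm_lt// => h i; rewrite /= in_itv/=.
have : (v 0 i - x 0 i) ^+ 2 < r ^+ 2.
  apply: le_lt_trans h; rewrite /dotrV (bigD1 i)//= !mxE -expr2 lerDl.
  by apply: sumr_ge0 => j _; rewrite -expr2 sqr_ge0.
rewrite -[X in X < _ -> _]real_normK ?num_real// ltr_sqr ?nnegrE ?(ltW r0)//.
by rewrite ltr_norml => /andP[? ?]; apply/andP; split; lra.
Qed.

Hypothesis d_gt0 : (0 < d)%N.

Lemma cube_sub_eball r : 0 < r -> cube x r `<=` eball x (d%:R * r).
Proof.
move=> r0 v h.
have d1 : (1 : R) <= d%:R by rewrite ler1n.
rewrite /eball/= enorm_lt; last by rewrite mulr_gt0// ltr0n.
apply: (@lt_le_trans _ _ (d%:R * r ^+ 2)).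
  rewrite mulr_natl -[in ltRHS](card_ord d) -sumr_const /dotrV.
  apply: ltr_sum; first by apply/hasP; exists (Ordinal d_gt0); rewrite ?mem_index_enum.
  move=> i _; rewrite !mxE -expr2; have := h i; rewrite /= in_itv/= => /andP[? ?].
  rewrite -real_normK ?num_real// ltr_sqr ?nnegrE ?(ltW r0)// ltr_norml.
  by apply/andP; split; lra.
rewrite exprMn ler_wpM2r ?sqr_ge0// expr2.
by rewrite ler_peMl// (le_trans ler01).
Qed.

(** The cube lies in the ball of radius [d r], whose volume is at most that of its circumscribed
    cube, [(2 d r) ^ d]. *)
Lemma lebesgue_point_cube (f : V -> R) : measurable_fun setT f ->
  lebesgue_point f x -> forall e, 0 < e ->
  \forall r \near (0 : R)^'+,
    (\int[lebesgue_rV d]_(u in cube x r) `|f u - f x|%:E <=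
     (e * (2 * d%:R * r) ^+ d)%:E)%E.
Proof.
move=> mf fx e e0.
have d0 : (0 : R) < d%:R by rewrite ltr0n.
have mfc B : measurable_fun B (fun u => `|f u - f x|%:E).
  apply: measurable_funTS; apply/measurable_EFinP.
  by apply: measurableT_comp => //; exact: measurable_funB.
have key rho : 0 < rho -> ((lebesgue_rV d (eball x rho))^-1 *
     \int[lebesgue_rV d]_(u in eball x rho) `|f u - f x|%:E <= e%:E)%E ->
   (\int[lebesgue_rV d]_(u in eball x rho) `|f u - f x|%:E <=
     (e * (2 * rho) ^+ d)%:E)%E.
  move=> rho0.
  have mE := measurable_eball rho0.
  have up : (lebesgue_rV d (eball x rho) <= ((2 * rho) ^+ d)%:E)%E.
    rewrite -lebesgue_rV_cube//; apply: le_measure; rewrite ?inE//.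
      exact: measurable_cube.
    exact: eball_sub_cube.
  (* Positive and finite volume makes the inverse in [\bar R] a real one, so that the average can be
     multiplied out. *)
  have low : (0 < lebesgue_rV d (eball x rho))%E.
    have rd : 0 < rho / d%:R by rewrite divr_gt0.
    apply: (@lt_le_trans _ _ (lebesgue_rV d (cube x (rho / d%:R)))).
      by rewrite lebesgue_rV_cube// lte_fin exprn_gt0// mulr_gt0.
    apply: le_measure; rewrite ?inE//; first exact: measurable_cube.
    have := @cube_sub_eball (rho / d%:R) rd.
    by rewrite mulrCA divff ?mulr1// gt_eqF.
  have lfin : lebesgue_rV d (eball x rho) \is a fin_num.
    by rewrite ge0_fin_numE ?measure_ge0// (le_lt_trans up)// ltry.
  set I := (\int[_]_(_ in _) _)%E.
  move: lfin low up; case: (lebesgue_rV d (eball x rho)) => // l _.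
  rewrite !lte_fin lee_fin => l0 lu h.
  rewrite inver gt_eqF// in h.
  have {}h : (I <= (e * l)%:E)%E.
    by move: h; rewrite muleC lee_pdivrMr// -EFinM.
  by apply: (le_trans h); rewrite lee_fin ler_wpM2l// ltW.
have near_avg : \forall rho \near (0 : R)^'+, ((lebesgue_rV d (eball x rho))^-1 *
     \int[lebesgue_rV d]_(u in eball x rho) `|f u - f x|%:E <= e%:E)%E.
  apply: (fx [set y | (y <= e%:E)%E]); exists e => //= y; rewrite /= sub0r normrN lee_fin => ye.
  by rewrite (le_trans (ler_norm _))// ltW.
case: near_avg => delta /= delta0 avg.
exists (delta / d%:R); first by rewrite /= divr_gt0.
move=> r /=; rewrite sub0r normrN => rd r0.
rewrite gtr0_norm// ltr_pdivlMr// mulrC in rd.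
have dr0 : 0 < d%:R * r by rewrite mulr_gt0.
apply: (@le_trans _ _ (\int[lebesgue_rV d]_(u in eball x (d%:R * r)) `|f u - f x|%:E)%E).
  apply: ge0_subset_integral => //.
  - exact: measurable_cube.
  - exact: measurable_eball.
  - exact: cube_sub_eball.
rewrite -mulrA; apply: key => //; apply: avg => //=.
by rewrite sub0r normrN gtr0_norm.
Qed.

End cube_measure.

Lemma exp_root (R : realType) d (y : R) : (0 < d)%N -> 0 < y ->
  exists2 t : R, 0 < t & t ^+ d = y.
Proof.
move=> d0 y0; exists (y `^ d%:R^-1); first exact: powR_gt0.
by rewrite -powR_mulrn ?powR_ge0// -powRrM mulVf ?powRr1 ?ltW// pnatr_eq0 -lt0n.
Qed.

Lemma tv_le_sym (R : realType) d (m m' : probability (config R d) R) e :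
  tv_le m m' e -> tv_le m' m e.
Proof.
move=> h A mA; have := h _ (measurableC mA).
have mfin (mu : probability (config R d) R) : mu A = (fine (mu A))%:E.
  by rewrite fineK// fin_num_measure.
by rewrite !probability_setC// mfin (mfin m') -!EFinB -!EFinD !lee_fin; lra.
Qed.

Lemma le_probability_off (R : realType) dO (O : measurableType dO)
    (P : probability O R) (U V W F : set O) :
  measurable U -> measurable V -> measurable W -> measurable F -> P F = 1%E ->
  (forall w, U w -> F w -> ~ W w -> V w) ->
  fine (P U) <= fine (P V) + fine (P W).
Proof.
move=> mU mV mW mF PF UV; rewrite -lee_fin EFinD !fineK ?fin_num_measure//.
rewrite -(probabilityI_conull mF PF mU).
apply: le_trans (measureU2 _ mV mW); apply: le_measure; rewrite ?inE.
- exact: measurableI.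
- exact: measurableU.
- by move=> w [Uw Fw]; have [Ww|nWw] := pselect (W w); [right|left; exact: UV].
Qed.

(** * The error bound at fixed n *)

Section fixed_n.
Context {R : realType} {d : nat}.
Local Notation V := 'rV[R]_d.
Variables (d_gt0 : (0 < d)%N) (f : V -> R) (f_density : probability_density f).
Variables (x : V) (fx_gt0 : 0 < f x) (G : polytope R d -> R).
Variables (n : nat) (n_gt0 : (0 < n)%N).
Hypotheses (GA : sample_measurable n f x G)
  (GP : process_measurable (n%:R * f x) x G).
Context dO {O : measurableType dO} (P : probability O R).
Variables (Y : 'I_1 -> {RV P >-> V}) (X : 'I_n -> {RV P >-> V}).
Hypotheses (Y_iid : iid_density Y f) (X_iid : iid_density X f).
Variables (Psi Phi : O -> set V).
Hypotheses (Psi_poisson : poisson_process P (f x) Psi)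
  (Phi_poisson : poisson_process P (n%:R * f x) Phi).
Variables (t e : R).
Hypothesis t_gt0 : 0 < t.
Let D : set V := cube x (4 * d%:R * t).
Hypothesis osc : (\int[lebesgue_rV d]_(u in D) `|f u - f x|%:E <= e%:E)%E.

Let r_gt0 : 0 < 4 * d%:R * t.
Proof. by rewrite !mulr_gt0// ltr0n. Qed.

Let mD : measurable D. Proof. exact: measurable_cube. Qed.
Let bD : bounded_set D. Proof. exact: bounded_cube. Qed.
Let lamD : fine (lebesgue_rV d D) = (2 * (4 * d%:R * t)) ^+ d.
Proof. by rewrite lebesgue_rV_cube. Qed.

(** The one-point sample [Y] realises the probability with density [f]. *)
Let Q : probability V R := distribution P (Y ord0).
Let Q_density B : measurable B ->
  Q B = (\int[lebesgue_rV d]_(y in B) (f y)%:E)%E.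
Proof. by move=> mB; exact: Y_iid.2. Qed.

Let tPsi : 0 < f x * fine (lebesgue_rV d D).
Proof. by rewrite lamD mulr_gt0// exprn_gt0// mulr_gt0. Qed.

Let tPhi : 0 < n%:R * f x * fine (lebesgue_rV d D).
Proof. by rewrite -mulrA mulr_gt0// ltr0n. Qed.

Let nuX := law Q (measurable_singleton mD).
Let nuP := law P (measurable_points Psi_poisson mD).
Let eps := n%:R * (2 * e + (f x * (2 * (4 * d%:R * t)) ^+ d) ^+ 2).

Let tv : tv_le (conv_pow nuX n) (conv_pow nuP n) eps.
Proof.
have [mf f_ge0 _] := f_density.
apply: tv_le_conv_pow; last first.
  rewrite -lamD.
  exact: (tv_le_single_point Psi_poisson mD bD tPsi mf f_ge0 fx_gt0 Q_density osc).
rewrite addr_ge0 ?sqr_ge0// mulr_ge0// -lee_fin; apply: le_trans osc.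
by apply: integral_ge0 => u _; rewrite lee_fin.
Qed.

Let kX := sample_config X D (enum 'I_n).
Let kP w := points (Phi w `&` D).

Let mkX : measurable_fun setT kX. Proof. exact: measurable_sample_config. Qed.
Let mkP : measurable_fun setT kP. Proof. exact: (measurable_points Phi_poisson mD). Qed.

Let law_kX A : measurable A -> P (kX @^-1` A) = conv_pow nuX n A.
Proof.
move=> mA; apply: (sample_config_law X_iid.1) => // i B mB.
by rewrite X_iid.2// Q_density.
Qed.

(** The independent copies of [Psi] live in the products inside [conv_pow], not on the space of [P];
    [Phi] matches their superposition because the rates agree. *)
Let law_kP A : measurable A -> P (kP @^-1` A) = conv_pow nuP n A.
Proof.
move=> mA.
have h1 := process_poisson_counts Phi_poisson mD bD tPhi.
have h2 := poisson_counts_conv_pow n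
  (process_poisson_counts Psi_poisson mD bD tPsi).
rewrite -(poisson_counts_unique h1 _ mA)//.
by congr poisson_counts : h2; apply/funext => B; rewrite mulrA.
Qed.

Let kXP A : measurable A -> fine (P (kX @^-1` A)) <= fine (P (kP @^-1` A)) + eps.
Proof.
move=> mA; rewrite -lee_fin EFinD law_kX// law_kP// !fineK ?fin_num_measure//.
exact: tv.
Qed.

Let kPX A : measurable A -> fine (P (kP @^-1` A)) <= fine (P (kX @^-1` A)) + eps.
Proof.
move=> mA; rewrite -lee_fin EFinD law_kX// law_kP// !fineK ?fin_num_measure//.
exact: (tv_le_sym tv).
Qed.

Let bad : set (config R d) :=
  \bigcup_(sigma in [set: {set 'I_d}]) [set s | count_in (corner x t sigma) s = 0%N].

Let mbad : measurable bad.
Proof.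
apply: fin_bigcup_measurable => [|sigma _]; first exact: finite_finset.
by apply: measurable_count_eq; exact: measurable_corner.
Qed.

Let badP : fine (P (kP @^-1` bad)) <= 2 ^+ d * expR (- (n%:R * f x * t ^+ d)).
Proof.
have h1 := process_poisson_counts Phi_poisson mD bD tPhi.
rewrite -lee_fin fineK ?fin_num_measure//; last first.
  by rewrite -[X in measurable X]setTI; exact: mkP.
rewrite /bad preimage_bigcup.
have mk sigma : measurable (kP @^-1` [set s | count_in (corner x t sigma) s = 0%N]).
  rewrite -[X in measurable X]setTI; apply: mkP => //.
  by apply: measurable_count_eq; exact: measurable_corner.
apply: (le_trans (measure_bigcup_fintype_le _ mk)).
rewrite (eq_bigr (fun=> (expR (- (n%:R * f x * t ^+ d)))%:E)); last first.
  move=> sigma _.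
  have E0 := h1 unit (fun=> corner x t sigma) (fun=> 0%N)
    (fun=> measurable_corner _ _ _).
  transitivity (P (kP @^-1` [set s | unit -> count_in (corner x t sigma) s = 0%N])).
    by congr (P _); apply/seteqP; split => w /=; [move=> h|move/(_ tt)].
  rewrite [LHS]E0; last by move=> [] [].
  rewrite big_const/= card_unit/= /pois expr0 fact0 divr1 mul1r mulr1.
  have -> : D `&` corner x t sigma = corner x t sigma.
    by apply: setIidr; exact: corner_sub_cube.
  by rewrite lebesgue_rV_corner.
rewrite sumEFin sumr_const.
rewrite lee_fin -[X in _ *+ X]cardsT -powersetT card_powerset cardsT card_ord.
by rewrite -natrX [leRHS]mulr_natl.
Qed.

(** [bad] is itself an event of configurations, so total variation carries the Poisson estimate over
    to the sample. *)
Let badX : fine (P (kX @^-1` bad)) <=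
  2 ^+ d * expR (- (n%:R * f x * t ^+ d)) + eps.
Proof. by apply: (le_trans (kXP mbad)); rewrite lerD2r. Qed.

Let nbadE s sigma : ~ bad s -> exists2 y, y \in (s : seq V) & corner x t sigma y.
Proof.
move=> nb; have : (0 < count_in (corner x t sigma) s)%N.
  by rewrite lt0n; apply/eqP => h; apply: nb; exists sigma.
by rewrite -has_count => /hasP[y ys /asboolP]; exists y.
Qed.

Let evX z := [set w | G (sample_cell x X w) <= z].
Let evP z := [set w | G (process_cell x Phi w) <= z].

Let mevX z : measurable (evX z).
Proof.
have sub : g_sigma_preimage X `<=` measurable.
  apply: smallest_sub; first exact: sigma_algebra_measurable.
  rewrite -bigcup_seq; apply: bigcup_sub => i _ A [B mB <-].
  exact: measurable_funP.
apply: sub; apply: (GA X_iid).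
exists `]-oo, z]%classic => //; rewrite setTI.
by apply/seteqP; split => w; rewrite /evX /preimage/= in_itv.
Qed.

Let mevP z : measurable (evP z).
Proof.
have [_ mN _] := Phi_poisson.
have sub : sigma_process Phi `<=` measurable.
  apply: smallest_sub; first exact: sigma_algebra_measurable.
  by move=> A [B mB [C mC <-]]; exact: mN.
apply: sub; apply: (GP Phi_poisson).
exists `]-oo, z]%classic => //; rewrite setTI.
by apply/seteqP; split => w; rewrite /evP /preimage/= in_itv.
Qed.

(** Off [bad] and a null event, each cell event says that the configuration lies in [A]. Leaving the
    sample costs [badX], crossing over costs [eps], returning costs [badP]; as [badX] contains
    another [eps], both terms are doubled. *)
Lemma cell_events_close z :
  `| fine (P [set w | G (sample_cell x X w) <= z])
   - fine (P [set w | G (process_cell x Phi w) <= z]) | <=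
  2 * (2 ^+ d * expR (- (n%:R * f x * t ^+ d))) +
  2 * (n%:R * (2 * e + (f x * (2 * (4 * d%:R * t)) ^+ d) ^+ 2)).
Proof.
rewrite -/eps -/(evX z) -/(evP z).
have [A mA AE] := process_event GP Phi_poisson z.
have mAX : measurable (kX @^-1` A).
  by rewrite -[X in measurable X]setTI; exact: mkX.
have mAP : measurable (kP @^-1` A).
  by rewrite -[X in measurable X]setTI; exact: mkP.
have mbX : measurable (kX @^-1` bad).
  by rewrite -[X in measurable X]setTI; exact: mkX.
have mbP : measurable (kP @^-1` bad).
  by rewrite -[X in measurable X]setTI; exact: mkP.
have [FX [mFX PFX injX]] : exists F : set O, [/\ measurable F, P F = 1%E &
    forall w, F w -> injective (fun i => X i w)].
  apply: (@sample_distinct _ _ _ _ _ _ X Q X_iid.1).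
    by move=> i B mB; rewrite X_iid.2// Q_density.
  move=> y; rewrite Q_density; last exact: measurable_set1_rV.
  apply: null_set_integral; first exact: measurable_set1_rV.
    apply: measurable_funTS; apply/measurable_EFinP.
    by have [] := f_density.
  exact: lebesgue_rV_set1.
have mFP := measurable_finite_process Phi_poisson mD.
have PFP := finite_process Phi_poisson mD bD tPhi.
have evXA w : FX w -> ~ (kX @^-1` bad) w -> evX z w <-> (kX @^-1` A) w.
  move=> /injX inj nb.
  have kXE : [set` kX w] = range (fun i => X i w) `&` D.
    apply/seteqP; split => y /=.
      rewrite mem_filter => /andP[/asboolP Dy /mapP[i _ yE]].
      by split => //; exists i.
    move=> [[i _ <-] Dy]; rewrite mem_filter; apply/andP; split; first exact/asboolP.
    by apply/mapP; exists i; rewrite ?mem_enum.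
  have us : uniq (kX w) by rewrite filter_uniq// map_inj_uniq// enum_uniq.
  rewrite /evX /preimage/= (propext (AE _ us)) kXE /sample_cell.
  rewrite (voronoi_cell_local d_gt0 t_gt0)// => sigma.
  have [y ykX yc] := nbadE sigma nb.
  have : [set` kX w] y by [].
  by rewrite kXE => -[ry _]; exists y.
have evPA w : finite_set (Phi w `&` D) -> ~ (kP @^-1` bad) w ->
    evP z w <-> (kP @^-1` A) w.
  move=> fw nb.
  have kPE := set_points fw.
  rewrite /evP /preimage/= (propext (AE _ (points_uniq _))) kPE /process_cell.
  rewrite (voronoi_cell_local d_gt0 t_gt0)// => sigma.
  have [y ykP yc] := nbadE sigma nb.
  have : [set` kP w] y by [].
  by rewrite kPE => -[ry _]; exists y.
have h1 := le_probability_off (mevX z) mAX mbX mFX PFX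
  (fun w u Fw nb => (evXA w Fw nb).1 u).
have h2 := le_probability_off mAX (mevX z) mbX mFX PFX
  (fun w u Fw nb => (evXA w Fw nb).2 u).
have h3 := le_probability_off (mevP z) mAP mbP mFP PFP
  (fun w u Fw nb => (evPA w Fw nb).1 u).
have h4 := le_probability_off mAP (mevP z) mbP mFP PFP
  (fun w u Fw nb => (evPA w Fw nb).2 u).
have := kXP mA; have := kPX mA; have := badX; have := badP.
move: h1 h2 h3 h4; rewrite ler_norml => *; apply/andP; split; lra.
Qed.

End fixed_n.

(** * Choice of the constants and the limit *)

(** Apply [y <= 1 + y <= expR y] at [y = k c], with [c] such that [k c = b / e]. *)
Lemma expR_decay (R : realType) (b k e : R) : 0 < b -> 0 < k -> 0 < e ->
  exists2 c, 0 < c & b * expR (- (k * c)) <= e.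
Proof.
move=> b0 k0 e0; exists (b / (k * e)); first by rewrite divr_gt0 ?mulr_gt0.
have -> : k * (b / (k * e)) = b / e by field; rewrite !gt_eqF.
rewrite expRN ler_pdivrMr ?expR_gt0// -ler_pdivrMl// mulrC.
by rewrite (le_trans _ (expR_ge1Dx _))// lerDr ler01.
Qed.

Theorem theorem1p2 (R : realType) (d : nat) (d_gt0 : (0 < d)%N)
    (f : 'rV[R]_d -> R) (f_density : probability_density f)
    (x : 'rV[R]_d) (fx : lebesgue_point f x) (fx_gt0 : 0 < f x)
    (G : polytope R d -> R)
    (GA : forall n, (0 < n)%N -> sample_measurable n f x G)
    (GP : forall n, (0 < n)%N -> process_measurable (n%:R * f x) x G)
    (dO : measure_display) (O : measurableType dO) (P : probability O R)
    (X : forall n, 'I_n -> {RV P >-> 'rV[R]_d})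
    (X_iid : forall n, (0 < n)%N -> iid_density (X n) f)
    (Phi : nat -> O -> set 'rV[R]_d)
    (Phi_poisson : forall n, (0 < n)%N ->
       poisson_process P (n%:R * f x) (Phi n)) :
  sup [set `| fine (P [set w | G (sample_cell x (X n) w) <= z])
            - fine (P [set w | G (process_cell x (Phi n) w) <= z]) |
      | z in [set: R]] @[n --> \oo] --> (0 : R).
Proof.
have [mf _ _] := f_density.
apply/cvgrPdist_le => eps eps0.
have dR : (0 : R) < d%:R by rewrite ltr0n.
have [c c0 hc] : exists2 c, 0 < c &
    (2 * 2 ^+ d) * expR (- (f x * c)) <= eps / 4.
  by apply: expR_decay; rewrite ?mulr_gt0 ?exprn_gt0 ?divr_gt0.
(* With [t ^ d = c / n], [M1 c / n] is the volume factor in the oscillation bound, and [M2 / n] is n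
   times the squared Poisson mean of the cube. *)
pose M1 : R := (8 * d%:R ^+ 2) ^+ d.
pose M2 : R := (f x * (8 * d%:R) ^+ d * c) ^+ 2.
have M10 : 0 < M1 by rewrite exprn_gt0// mulr_gt0// exprn_gt0.
(* Makes [2 n eps' M1 c / n] equal to [eps / 8]. Empty corners, oscillation and the quadratic term
   then cost at most [eps / 4] each. *)
pose eps' := eps / (16 * M1 * c).
have eps'0 : 0 < eps' by rewrite divr_gt0// !mulr_gt0.
have [delta /= delta0 osc] := lebesgue_point_cube d_gt0 mf fx eps'0.
(* [c / n < h] means [4 d t < delta]. *)
pose h := (delta / (4 * d%:R)) ^+ d.
have h0 : 0 < h by rewrite exprn_gt0// divr_gt0// mulr_gt0.
near=> n.
have n0 : (0 < n)%N by near: n; exact: nbhs_infty_gt.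
have nR : (0 : R) < n%:R by rewrite ltr0n.
have nh : c / n%:R < h.
  rewrite ltr_pdivrMr// mulrC -ltr_pdivrMr//.
  by near: n; exact: nbhs_infty_gtr.
have nM2 : 8 * M2 / eps <= n%:R by near: n; exact: nbhs_infty_ger.
have [t t0 tE] := exp_root d_gt0 (divr_gt0 c0 nR).
have r0 : 0 < 4 * d%:R * t by rewrite !mulr_gt0.
have oscn := osc (4 * d%:R * t).
have {oscn} /(_ _ r0) oscn := oscn.
have {}oscn : (\int[lebesgue_rV d]_(u in cube x (4 * d%:R * t)) `|f u - f x|%:E <=
     (eps' * (2 * d%:R * (4 * d%:R * t)) ^+ d)%:E)%E.
  apply: oscn; rewrite /= sub0r normrN gtr0_norm// mulrC -ltr_pdivlMr ?mulr_gt0//.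
  by rewrite -(ltr_pXn2r d_gt0) ?nnegrE ?ltW ?divr_gt0 ?mulr_gt0// tE.
have Psi_poisson : poisson_process P (f x) (Phi 1%N).
  by have := Phi_poisson 1%N isT; rewrite mul1r.
have close z := cell_events_close d_gt0 f_density fx_gt0 n0 (GA n n0) (GP n n0)
  (X_iid 1%N isT) (X_iid n n0) Psi_poisson (Phi_poisson n n0) t0 oscn z.
have bound : 2 * (2 ^+ d * expR (- (n%:R * f x * t ^+ d))) +
  2 * (n%:R * (2 * (eps' * (2 * d%:R * (4 * d%:R * t)) ^+ d) +
    (f x * (2 * (4 * d%:R * t)) ^+ d) ^+ 2)) <= eps.
  have -> : n%:R * f x * t ^+ d = f x * c.
    by rewrite tE; field; rewrite gt_eqF.
  have -> : (2 * d%:R * (4 * d%:R * t)) ^+ d = M1 * (c / n%:R).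
    by rewrite -tE /M1 -exprMn; congr (_ ^+ _); ring.
  have -> : (2 * (4 * d%:R * t)) ^+ d = (8 * d%:R) ^+ d * (c / n%:R).
    by rewrite -tE -exprMn; congr (_ ^+ _); ring.
  have -> : n%:R * (2 * (eps' * (M1 * (c / n%:R))) +
      (f x * ((8 * d%:R) ^+ d * (c / n%:R))) ^+ 2) = eps / 8 + M2 / n%:R.
    by rewrite /eps' /M2; field; rewrite !gt_eqF.
  have : M2 / n%:R <= eps / 8.
    by move: nM2; rewrite !ler_pdivrMr//; lra.
  by move: hc; rewrite -mulrA; lra.
set S := [set _ | _ in _].
(* [sup] is the least upper bound only of a nonempty set bounded above. *)
have Sub : ubound S eps by move=> _ [z _ <-]; exact: le_trans (close z) bound.
have S0 : S !=set0 by eexists; exists 0.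
rewrite sub0r normrN ger0_norm; first exact: ge_sup.
have [y Sy] := S0; apply: (@le_trans _ _ y); first by have [z _ <-] := Sy.
by apply: ub_le_sup => //; exists eps.
Unshelve. all: by end_near. Qed.
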